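(* Let $1\le p\le\infty$, $1<r<\infty$, $\kappa\in\mathbb{R}$, and let $\lambda:\mathbb{R}\to\mathbb{R}\setminus\{0\}$ be a bounded function which is a mask of type $(r,\kappa)$. Then there exists a positive constant $c$ such that for all $f\in\mathcal{H}_{\lambda,p}(\mathbb{T})$ and all $m\in\mathbb{N}$, $$\|f-Q_{m,\lambda}(f)\|_p\le c\,m^{-r}(\log(m+1))^{-\kappa}\,\|f\|_{\mathcal{H}_{\lambda,p}(\mathbb{T})}.$$
   Context: $\mathbb{T}$ is the torus $[0,2\pi]$ with endpoints identified; $L^p(\mathbb{T})$ has norm $\|f\|_p=\big(\frac1{2\pi}\int_{\mathbb{T}}|f|^p\big)^{1/p}$ for $p<\infty$ and the essential supremum norm for $p=\infty$ (functions may be taken real or complex valued). Convolution is normalized, $(f_1*f_2)(x)=\frac{1}{2\pi}\int_{\mathbb{T}}f_1(x-t)f_2(t)\,dt$, so that Fourier coefficients $\widehat f(k)=\frac1{2\pi}\int_{\mathbb{T}}f(x)e^{-ikx}dx$ multiply. For a bounded function $\lambda:\mathbb{R}\to\mathbb{R}\setminus\{0\}$, $\varphi_\lambda(x):=\sum_{k\in\mathbb{Z}}\lambda(k)e^{ikx}$, and $\mathcal{H}_{\lambda,p}(\mathbb{T}):=\{f=\varphi_\lambda*g:\ g\in L^p(\mathbb{T})\}$ with norm $\|f\|_{\mathcal{H}_{\lambda,p}(\mathbb{T})}:=\|g\|_p$. For $r,\kappa\in\mathbb{R}$, a function $f:\mathbb{R}\to\mathbb{R}$ is a mask of type $(r,\kappa)$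 if $f$ is even, 2-times continuously differentiable, and for $t\ge1$, $f(t)=|t|^{-r}(\log(|t|+1))^{-\kappa}F(\log|t|)$ for some (twice differentiable) $F:\mathbb{R}\to\mathbb{R}$ such that, for a constant $a_1$, $|F^{(k)}(t)|\le a_1$ for all $t\ge1$, $k=0,1,2$. Fix a 2-times continuously differentiable $\vartheta:\mathbb{R}\to\mathbb{R}$ with $\vartheta(x)=1$ for $x\in[-\frac12,\frac12]$ and $\vartheta(x)=0$ for $x\notin(-1,1)$. Put $H_m(x):=\sum_{k\in\mathbb{Z}}\vartheta(k/m)e^{ikx}$ and $V_m(g):=H_m*g$. For $f=\varphi_\lambda*g\in\mathcal{H}_{\lambda,p}(\mathbb{T})$, $$Q_{m,\lambda}(f):=\frac1{2m+1}\sum_{k=0}^{2m}V_m(g)\Big(\frac{2\pi k}{2m+1}\Big)\,\varphi_\lambda\Big(\cdot-\frac{2\pi k}{2m+1}\Big).$$ *)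

(* Defs.v *)
From HB Require Import structures.
From mathcomp Require Import all_boot all_order all_algebra.
From mathcomp Require Import all_classical all_reals all_analysis.
From mathcomp Require Import complex.

Set Implicit Arguments.
Unset Strict Implicit.
Unset Printing Implicit Defensive.

Import Order.TTheory GRing.Theory Num.Theory.
Import numFieldNormedType.Exports.

Local Open Scope classical_set_scope.
Local Open Scope ring_scope.
Local Open Scope complex_scope.

Lemma two_pi_gt0 (R : realType) : 0 < pi *+ 2 :> R.
Proof. by rewrite pmulrn_lgt0 ?pi_gt0. Qed.

(* The normalized Lebesgue measure dx / (2 pi) on [0, 2 pi]. Functions on the
   torus are represented by 2 pi-periodic functions on the real line. *)
Definition torus_measure (R : realType) : probability (measurableTypeR R) R :=
  uniform_prob (two_pi_gt0 R).

Definition complex_measurable (R : realType) (f : R -> R[i]) : Prop :=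
  measurable_fun [set: measurableTypeR R] (fun x => complex.Re (f x)) /\
  measurable_fun [set: measurableTypeR R] (fun x => complex.Im (f x)).

(* The factor 1 / (2 pi) is part of the measure. *)
Definition torus_integral (R : realType) (f : R -> R[i]) : R[i] :=
  Rintegral (torus_measure R) [set: measurableTypeR R]
    (fun x => complex.Re (f x))
  +i* Rintegral (torus_measure R) [set: measurableTypeR R]
    (fun x => complex.Im (f x)).

Definition torus_norm (R : realType) (p : \bar R) (f : R -> R[i]) : \bar R :=
  Lnorm (torus_measure R) p
    (fun x : measurableTypeR R => (Normc.normc (f x))%:E).

Definition torus_Lp (R : realType) (p : \bar R) : set (R -> R[i]) :=
  [set f | [/\ complex_measurable f, periodic f (pi *+ 2)
             & (torus_norm p f < +oo)%E]].

Definition torus_conv (R : realType) (f1 f2 : R -> R[i]) (x : R) : R[i] :=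
  torus_integral (fun t => f1 (x - t) * f2 t).

Definition expi (R : realType) (x : R) : R[i] := cos x +i* sin x.

(* The trigonometric series \sum_(k in Z) a(k) e^{ikx}, as the limit of its
   symmetric partial sums over -n <= k <= n. *)
Definition trig_series (R : realType) (a : int -> R) (x : R) : R[i] :=
  limn (fun n : nat =>
    \sum_(j < n.*2.+1)
      (a (j%:Z - n%:Z))%:C * expi ((j%:Z - n%:Z)%:~R * x) : R[i]^o).

Definition phi (R : realType) (lam : R -> R) : R -> R[i] :=
  trig_series (fun k : int => lam k%:~R).

(* [generates lam p f g] says that f = phi_lam * g is an element of H_{lam,p}
   with generator g, where f is any representative of its class in L^p. Since
   lam does not vanish, g is determined by f up to almost everywhere equality,
   so that the norm of f in H_{lam,p} is the L^p norm of g. *)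
Definition generates (R : realType) (lam : R -> R) (p : \bar R)
    (f g : R -> R[i]) : Prop :=
  [/\ torus_Lp p f, torus_Lp p g
    & {ae torus_measure R, forall x, f x = torus_conv (phi lam) g x}].

Definition twice_derivable (R : realType) (f : R -> R) : Prop :=
  (forall x, derivable f x 1) /\ (forall x, derivable (derive1 f) x 1).

Definition C2 (R : realType) (f : R -> R) : Prop :=
  twice_derivable f /\ continuous (derive1n 2 f).

Definition is_mask (R : realType) (r kappa : R) (f : R -> R) : Prop :=
  [/\ forall t, f (- t) = f t,
      C2 f
    & exists F : R -> R, exists a1 : R,
      [/\ twice_derivable F,
          forall t, 1 <= t ->
            f t = `|t| `^ (- r) * ln (`|t| + 1) `^ (- kappa) * F (ln `|t|)
        & forall (t : R) (k : nat), 1 <= t -> (k <= 2)%N ->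
            `|derive1n k F t| <= a1]].

Definition cutoff (R : realType) (theta : R -> R) : Prop :=
  [/\ C2 theta,
      forall x, - 2^-1 <= x <= 2^-1 -> theta x = 1
    & forall x, ~ (- 1 < x < 1) -> theta x = 0].

Definition kernelH (R : realType) (theta : R -> R) (m : nat) : R -> R[i] :=
  trig_series (fun k : int => theta (k%:~R / m%:R)).

Definition opV (R : realType) (theta : R -> R) (m : nat) (g : R -> R[i])
    : R -> R[i] :=
  torus_conv (kernelH theta m) g.

Definition node (R : realType) (m k : nat) : R :=
  pi *+ 2 * k%:R / (m.*2.+1)%:R.

(* Q_{m,lam}(f) for f = phi_lam * g, as a function of the generator g. *)
Definition opQ (R : realType) (theta lam : R -> R) (m : nat) (g : R -> R[i])
    (x : R) : R[i] :=
  ((m.*2.+1)%:R)^-1 *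
    \sum_(0 <= k < m.*2.+1)
      opV theta m g (node R m k) * phi lam (x - node R m k).

(* Main.v *)
Require Import Defs.
From HB Require Import structures.
From mathcomp Require Import all_boot all_order all_algebra.
From mathcomp Require Import all_classical all_reals all_analysis.
From mathcomp Require Import complex.
From mathcomp Require Import measurable_realfun ess_sup_inf ring lra zify.

Set Implicit Arguments.
Unset Strict Implicit.
Unset Printing Implicit Defensive.

Import Order.TTheory GRing.Theory Num.Theory.
Import numFieldNormedType.Exports.

Local Open Scope classical_set_scope.
Local Open Scope ring_scope.

(** The error is an integral operator, [(f - Q f)(x) = int K(x, t) g(t) dt], and the
    theorem follows from a pointwise bound on [K]: with [omega] the rate in the statement,

      [|K(x, t)| <= A omega(m) m / (1 + m^2 (2 - 2 cos (x - t)))].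

    The right-hand side is [omega(m)] times a bump of height [m] and width [1/m]
    ([fejer_weight]), whose integral in either variable is bounded uniformly in [m]
    ([integral_fejer_weight]); the Schur test ([schur_test]) then bounds the operator
    norm on every [L^p] by a constant times [omega(m)].

    To bound [K], put [N = 2 m + 1]. Averaging exponentials over the [N] nodes keeps only
    the frequencies congruent modulo [N] ([sampling_sum]). Hence, with [y = x - t],

      [K(x, t) = sum_k lam(k) (1 - theta(k/m)) e^{iky}
                 - sum_{l <> 0} e^{ilNx} sum_{|j| <= m} lam(j + l N) theta(j/m) e^{ijy}],

    a high-frequency part and the aliases of the low frequencies ([partial_kernelE]).
    Each inner sum is controlled by two numbers: the sum of the moduli of its
    coefficients, which bounds the sum itself, and the sum of the moduli of their second
    differences, which by summation by parts bounds [2 - 2 cos y] times the sum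
    ([trigsum_decay]). If the first is [O(m M)] and the second [O(M / m)], the sum is
    [O(M)] times the Fejer weight ([fejer_domination]).

    These two estimates hold because a mask is a symbol: it is [O(omega)], and each
    difference gains a factor [O(1/|k|)] ([mask_differences_le]), while the cutoff gains
    [O(1/m)] per difference. The high-frequency coefficients live on [|k| >= m/2],
    where [omega] decays, up to a constant, like [omega(m) (|k|/m)^(- (1 + r)/2)]
    ([omega_potter]); the coefficients of the alias number [l] are, up to a
    constant, at most [omega(m) |l|^(- (1 + r)/2)]. As [r > 1], both decays are summable. *)

(** * Slow variation of the decay rate *)

Section Potter.
Context {R : realType}.
Implicit Types (r kappa s t q d : R).

(** The value at [t = m] of this function is the rate in the theorem. *)
Definition omega r kappa t : R := t `^ (- r) * ln (t + 1) `^ (- kappa).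

Lemma ln_le_powR d q : 0 < d -> 0 < q -> ln q <= d^-1 * q `^ d.
Proof.
move=> d0 q0; rewrite ler_pdivlMl// -ln_powR.
have y0 : 0 < q `^ d by exact: powR_gt0.
have : ln (1 + (q `^ d - 1)) <= q `^ d - 1 by apply: le_ln1Dx; lra.
by rewrite addrC subrK; lra.
Qed.

Lemma ln_add1_ge_half t : 1 <= t -> 2^-1 <= ln (t + 1).
Proof.
move=> t1; have t0 : 0 < t + 1 by lra.
have : ln (1 + ((t + 1)^-1 - 1)) <= (t + 1)^-1 - 1.
  by apply: le_ln1Dx; have := invr_gt0 (t + 1); rewrite t0; lra.
rewrite addrC subrK lnV//.
have : (t + 1)^-1 <= 2^-1 by rewrite lef_pV2 ?posrE//; lra.
lra.
Qed.

Lemma ln_add1_gt0 t : 1 <= t -> 0 < ln (t + 1).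
Proof. by move=> /ln_add1_ge_half; lra. Qed.

Lemma omega_gt0 r kappa t : 1 <= t -> 0 < omega r kappa t.
Proof.
move=> t1; rewrite mulr_gt0 ?powR_gt0 ?ln_add1_gt0//.
by rewrite (lt_le_trans _ t1).
Qed.

(** For [kappa > 0] the logarithm at [s] is at least a third of the one at [t], as
    [t <= 4 s]. For [kappa <= 0] one uses that a logarithm grows slower than any power:
    [ln (s + 1) <= ln q + ln (t + 1)] with [ln q = O(q ^ d)], and [d] small enough to
    absorb the exponent [- kappa]. *)
Lemma ln_power_ratio kappa (e : R) : 0 < e ->
  exists2 D : R, 0 < D & forall s t q, 1 <= s -> 1 <= t -> 1 <= q ->
    4 * s = q * t -> ln (s + 1) `^ (- kappa) <= D * q `^ e * ln (t + 1) `^ (- kappa).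
Proof.
move=> e0; have [k0|k0] := leP kappa 0; last first.
  exists (3 `^ kappa); first by rewrite powR_gt0.
  move=> s t q s1 t1 q1 sqt.
  have Ls := ln_add1_ge_half s1; have Lt := ln_add1_ge_half t1.
  have L : ln (t + 1) <= 3 * ln (s + 1).
    rewrite (_ : 3 * _ = ln ((s + 1) ^+ 3)); last first.
      by rewrite lnXn ?mulr_natl//; lra.
    rewrite ler_ln ?posrE; [|lra|by rewrite exprn_gt0; lra].
    have : t <= 4 * s by rewrite sqt ler_peMl//; lra.
    move=> /le_trans h; rewrite -lerBrDr; apply: h.
    by nra.
  rewrite !powRN.
  have q1' : 1 <= q `^ e.
    by rewrite -(powRr0 q) ler_powR// ltW.
  apply: (@le_trans _ _ (3 `^ kappa * (ln (t + 1) `^ kappa)^-1)); last first.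
    rewrite ler_wpM2r ?invr_ge0 ?powR_ge0//.
    by rewrite ler_peMr ?powR_ge0.
  have Ls0 : 0 < ln (s + 1) by lra.
  have Lt0 : 0 < ln (t + 1) by lra.
  rewrite ler_pdivlMr ?powR_gt0//.
  rewrite mulrC ler_pdivrMr ?powR_gt0//.
  rewrite -powRM; [|lra|lra].
  by apply: ge0_ler_powR; rewrite ?nnegrE//; lra.
set K := - kappa; have K0 : 0 <= K by rewrite oppr_ge0.
(* [d K <= e], with K + 1 to allow for K = 0. *)
pose d := e / (K + 1); have d0 : 0 < d by rewrite divr_gt0//; lra.
have d0' : 0 < d^-1 by rewrite invr_gt0.
exists ((2 * d^-1 + 1) `^ K); first by rewrite powR_gt0; lra.
move=> s t q s1 t1 q1 sqt.
have Ls := ln_add1_ge_half s1; have Lt := ln_add1_ge_half t1.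
have qd1 : 1 <= q `^ d by rewrite -(powRr0 q) ler_powR// ltW.
have L : ln (s + 1) <= (2 * d^-1 + 1) * q `^ d * ln (t + 1).
  apply: (@le_trans _ _ (ln (q * (t + 1)))).
    rewrite ler_ln ?posrE; [nra|lra|nra].
  rewrite lnM ?posrE; [|lra|lra].
  have q0 : 0 < q by lra.
  have A := ln_le_powR d0 q0.
  have B : d^-1 * q `^ d <= d^-1 * q `^ d * (2 * ln (t + 1)).
    by rewrite ler_peMr ?mulr_ge0//; lra.
  have B' : ln (t + 1) <= q `^ d * ln (t + 1) by rewrite ler_peMl//; lra.
  lra.
apply: (@le_trans _ _ (((2 * d^-1 + 1) * q `^ d * ln (t + 1)) `^ K)).
  apply: ge0_ler_powR; rewrite ?nnegrE//; lra.
rewrite powRM; [|by rewrite mulr_ge0 ?powR_ge0//; lra|lra].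
rewrite powRM; [|lra|exact: powR_ge0].
rewrite ler_wpM2r ?powR_ge0// ler_wpM2l ?powR_ge0// -powRrM ler_powR//.
by rewrite /d mulrAC ler_pdivrMr; [nra|lra].
Qed.

(** A Potter bound. The logarithmic factor costs at most a small power of [s / t], so
    that [omega] still decays like a power of exponent [(1 + r) / 2 > 1]. Every later sum
    of [omega] over frequencies is thereby reduced to a sum of powers, and the
    factor 4 leaves room for the shifts by one and the factor 1/2 that occur below. *)
Lemma omega_potter r kappa : 1 < r ->
  exists2 C : R, 0 < C & forall s t, 1 <= s -> 1 <= t -> t <= 4 * s ->
    omega r kappa s <= C * omega r kappa t * (s / t) `^ (- ((1 + r) / 2)).
Proof.
move=> r1.
have e0 : 0 < (r - 1) / 2 by lra.
have [D D0 HD] := ln_power_ratio kappa e0.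
exists (4 `^ ((r - 1) / 2) * D) => [|s t s1 t1 ts].
  by rewrite mulr_gt0 ?powR_gt0.
pose q := 4 * (s / t).
have st0 : 0 < s / t by rewrite divr_gt0; lra.
have q1 : 1 <= q by rewrite /q mulrA ler_pdivlMr; lra.
have sqt : 4 * s = q * t by rewrite /q; field; lra.
have {}HD := HD s t q s1 t1 q1 sqt.
rewrite /omega.
have -> : s `^ (- r) = (s / t) `^ (- r) * t `^ (- r).
  by rewrite -powRM; [congr powR; field; lra|exact: ltW|lra].
apply: (@le_trans _ _ ((s / t) `^ (- r) * t `^ (- r) *
   (D * q `^ ((r - 1) / 2) * ln (t + 1) `^ (- kappa)))).
  by rewrite ler_wpM2l// mulr_ge0 ?powR_ge0.
have -> : q `^ ((r - 1) / 2) = 4 `^ ((r - 1) / 2) * (s / t) `^ ((r - 1) / 2).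
  by rewrite -powRM//; exact: ltW.
have -> : - ((1 + r) / 2) = - r + (r - 1) / 2 by lra.
rewrite (@powRD _ (s / t)); last by rewrite (gt_eqF st0) implybT.
by rewrite le_eqVlt; apply/orP; left; apply/eqP; ring.
Qed.

End Potter.

(** * Differences bounded by derivatives *)

Section SecondDifferences.
Context {R : realType}.
Implicit Types (f : R -> R) (a b x h M : R).

Lemma MVT_le f (f' : R -> R) a b M : a < b ->
  (forall x, a <= x <= b -> is_derive x 1 f (f' x)) ->
  (forall x, a <= x <= b -> `|f' x| <= M) -> `|f b - f a| <= M * (b - a).
Proof.
move=> ab df bf.
have [|x|c cab ->] := @MVT R f f' a b ab.
- by move=> x; rewrite in_itv/= => /andP[/ltW ax /ltW xb]; apply: df; rewrite ax.
- apply: derivable_within_continuous => y; rewrite in_itv/= => yab.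
  by have [] := df y yab.
- rewrite normrM (gtr0_norm (x := b - a)); last by rewrite subr_gt0.
  rewrite ler_wpM2r//; first by rewrite subr_ge0 ltW.
  by apply: bf; move: cab; rewrite in_itv/= => /andP[/ltW -> /ltW ->].
Qed.

Lemma is_derive_shift h x : is_derive x 1 (fun s : R => s + h) 1.
Proof.
have := is_deriveD (is_derive_id x (1 : R)) (is_derive_cst h x (1 : R)).
by rewrite addr0.
Qed.

(** Two mean value arguments: the second difference at [x] is the increment over
    [[x - h, x]] of the function [s |-> f (s + h) - f s], whose derivative is itself an
    increment of [f']. *)
Lemma second_difference_le f (f' f2 : R -> R) x h M : 0 < h ->
  (forall y, x - h <= y <= x + h -> is_derive y 1 f (f' y)) ->
  (forall y, x - h <= y <= x + h -> is_derive y 1 f' (f2 y)) ->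
  (forall y, x - h <= y <= x + h -> `|f2 y| <= M) ->
  `|f (x + h) - 2 * f x + f (x - h)| <= M * h ^+ 2.
Proof.
move=> h0 df df' bf.
pose g s := f (s + h) - f s.
have -> : f (x + h) - 2 * f x + f (x - h) = g x - g (x - h).
  by rewrite /g subrK; ring.
have -> : M * h ^+ 2 = M * h * (x - (x - h)) by ring.
apply: (@MVT_le g (fun s => f' (s + h) - f' s)); first by lra.
- move=> y yxh.
  have dfyh : is_derive (y + h) 1 f (f' (y + h)) by apply: df; lra.
  have dfy : is_derive y 1 f (f' y) by apply: df; lra.
  apply: is_deriveB => //.
  have := @is_derive1_comp R f (fun s => s + h) y (f' (y + h)) 1 dfyh.
  by rewrite mulr1; apply; exact: is_derive_shift.
- move=> y yxh.
  have -> : M * h = M * (y + h - y) by ring.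
  apply: (@MVT_le f' f2); first by lra.
  + by move=> z zy; apply: df'; lra.
  + by move=> z zy; apply: bf; lra.
Qed.

End SecondDifferences.

(** * Derivatives of a mask in logarithmic form *)

Section MaskDerivatives.
Context {R : realType}.
Variables (r kappa : R) (F : R -> R).
Hypothesis dF : forall x : R, is_derive x 1 F (derive1 F x).
Hypothesis ddF : forall x : R, is_derive x 1 (derive1 F) (derive1n 2 F x).

(** Writing [omega] as the exponential of this function makes its derivatives
    polynomial in [dlogomega] and [ddlogomega], which are [O(1/t)] and [O(1/t^2)]. *)
Definition logomega (t : R) : R := - r * ln t - kappa * ln (ln (t + 1)).
Definition dlogomega (t : R) : R := - r / t - kappa / ((t + 1) * ln (t + 1)).
Definition ddlogomega (t : R) : R := r / t ^+ 2 +
  kappa * (ln (t + 1) + 1) / ((t + 1) * ln (t + 1)) ^+ 2.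

Lemma omegaE (t : R) : 1 <= t -> omega r kappa t = expR (logomega t).
Proof.
move=> t1; rewrite /omega /powR gt_eqF; last by lra.
rewrite gt_eqF ?ln_add1_gt0// -expRD; congr expR.
by rewrite /logomega; ring.
Qed.

Lemma is_derive_ln_add1 (t : R) : 1 <= t -> is_derive t 1 (fun s : R => ln (s + 1)) (t + 1)^-1.
Proof.
move=> t1; have t0 : 0 < t + 1 by lra.
have := @is_derive1_comp R (@ln R) (fun s => s + 1) t _ 1 (is_derive1_ln t0).
by rewrite mulr1; apply; exact: is_derive_shift.
Qed.

Lemma is_derive_logomega (t : R) : 1 <= t -> is_derive t 1 logomega (dlogomega t).
Proof.
move=> t1; have t0 : 0 < t by lra.
have d1 := is_derive1_ln t0.
have l0 := ln_add1_gt0 t1.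
have d2 := @is_derive1_comp R (@ln R) (fun s => ln (s + 1)) t _ _ (is_derive1_ln l0) (is_derive_ln_add1 t1).
have := is_deriveB (is_deriveZ (- r) d1) (is_deriveZ kappa d2).
move=> h; apply: is_derive_eq h _.
by rewrite /dlogomega /GRing.scale/= invfM; ring.
Qed.

Lemma is_derive_dlogomega (t : R) : 1 <= t -> is_derive t 1 dlogomega (ddlogomega t).
Proof.
move=> t1; have t0 : 0 < t by lra.
have l0 := ln_add1_gt0 t1.
have tn : t != 0 by lra.
have d1 := @is_deriveV R id t 1 1 tn (is_derive_id t 1).
have d2 := is_derive_ln_add1 t1.
have d3 : is_derive t 1 (fun s : R => s + 1) 1.
  exact: is_derive_shift.
have pn : (t + 1) * ln (t + 1) != 0 by rewrite mulf_neq0//; lra.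
have d4 := @is_deriveV R (fun s => (s + 1) * ln (s + 1)) t _ _ pn (is_deriveM d3 d2).
have := is_deriveB (is_deriveZ (- r) d1) (is_deriveZ kappa d4).
move=> h; apply: is_derive_eq h _.
rewrite /ddlogomega /GRing.scale/=.
by field; rewrite tn !gt_eqF//; lra.
Qed.

(** On [t >= 1] a mask coincides with this function, whose derivatives are explicit in
    terms of those of [F]. *)
Definition log_mask (t : R) : R := expR (logomega t) * F (ln t).
Definition dlog_mask (t : R) : R :=
  expR (logomega t) * (dlogomega t * F (ln t) + derive1 F (ln t) / t).
Definition ddlog_mask (t : R) : R := expR (logomega t) *
  ((dlogomega t ^+ 2 + ddlogomega t) * F (ln t)
   + (2 * dlogomega t / t - (t ^+ 2)^-1) * derive1 F (ln t)
   + derive1n 2 F (ln t) / t ^+ 2).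

Lemma is_derive_mask (t : R) : 1 <= t -> is_derive t 1 log_mask (dlog_mask t).
Proof.
move=> t1; have t0 : 0 < t by lra.
have d1 := @is_derive1_comp R F (@ln R) t _ _ (dF (ln t)) (is_derive1_ln t0).
have d2 := @is_derive1_comp R (@expR R) logomega t _ _ (is_derive_expR (logomega t)) (is_derive_logomega t1).
move: (is_deriveM d2 d1) => h; apply: is_derive_eq h _.
by rewrite /dlog_mask /GRing.scale/=; ring.
Qed.

Lemma is_derive_dmask (t : R) : 1 <= t -> is_derive t 1 dlog_mask (ddlog_mask t).
Proof.
move=> t1; have t0 : 0 < t by lra.
have tn : t != 0 by lra.
have d0 := @is_derive1_comp R F (@ln R) t _ _ (dF (ln t)) (is_derive1_ln t0).
have d1 := @is_derive1_comp R (derive1 F) (@ln R) t _ _ (ddF (ln t)) (is_derive1_ln t0).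
have d2 := @is_derive1_comp R (@expR R) logomega t _ _ (is_derive_expR (logomega t)) (is_derive_logomega t1).
have d3 := @is_deriveV R id t 1 1 tn (is_derive_id t 1).
have d4 := is_derive_dlogomega t1.
move: (is_deriveM d2 (is_deriveD (is_deriveM d4 d0) (is_deriveM d1 d3))) => h.
apply: is_derive_eq h _.
rewrite /ddlog_mask /GRing.scale/=.
rewrite [X in _ + X * _ = _](_ : _ =
  dlogomega t * F (ln t) + derive1 F (ln t) / t)//.
by field.
Qed.

Lemma dlogomega_le (t : R) : 1 <= t -> `|dlogomega t| <= (`|r| + 2 * `|kappa|) / t.
Proof.
move=> t1; have t0 : 0 < t by lra.
have l0 := ln_add1_gt0 t1; have l1 := ln_add1_ge_half t1.
rewrite /dlogomega [leRHS]mulrDl (le_trans (ler_normB _ _))// lerD//.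
  by rewrite normrM normrN normfV (gtr0_norm t0).
have p0 : 0 < (t + 1) * ln (t + 1) by rewrite mulr_gt0//; lra.
rewrite normrM normfV (gtr0_norm p0) mulrC ler_pdivrMl//.
rewrite mulrA ler_pdivlMr//.
rewrite -subr_ge0; have k0 := normr_ge0 kappa.
have -> : (t + 1) * ln (t + 1) * (2 * `|kappa|) - `|kappa| * t =
  `|kappa| * ((t + 1) * (2 * ln (t + 1)) - t) by ring.
rewrite mulr_ge0//; nra.
Qed.

Lemma ddlogomega_le (t : R) : 1 <= t -> `|ddlogomega t| <= (`|r| + 6 * `|kappa|) / t ^+ 2.
Proof.
move=> t1; have t0 : 0 < t by lra.
have l0 := ln_add1_gt0 t1; have l1 := ln_add1_ge_half t1.
rewrite /ddlogomega [leRHS]mulrDl (le_trans (ler_normD _ _))// lerD//.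
  by rewrite normrM normfV (gtr0_norm (exprn_gt0 _ t0)).
have p0 : 0 < ((t + 1) * ln (t + 1)) ^+ 2 by rewrite exprn_gt0// mulr_gt0//; lra.
rewrite normrM normfV (gtr0_norm p0) normrM (gtr0_norm (x := ln _ + 1)); last by lra.
rewrite ler_pdivrMr// mulrAC ler_pdivlMr ?exprn_gt0//.
rewrite -subr_ge0; have k0 := normr_ge0 kappa.
set L := ln _ in l0 l1 *.
have -> : 6 * `|kappa| * ((t + 1) * L) ^+ 2 - `|kappa| * (L + 1) * t ^+ 2 =
  `|kappa| * ((t + 1) ^+ 2 * (6 * L ^+ 2) - t ^+ 2 * (L + 1)) by ring.
rewrite mulr_ge0// subr_ge0 ler_pM//; [by rewrite exprn_ge0//; lra|lra| |nra].
by rewrite lerXn2r ?nnegrE; lra.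
Qed.

End MaskDerivatives.

Section MaskBounds.
Context {R : realType}.

Lemma derivable_is_derive1 (f : R -> R) (x : R) :
  derivable f x 1 -> is_derive x 1 f (derive1 f x).
Proof. by move=> df; rewrite derive1E; exact: derivableP. Qed.

(** The bounds on [F] apply at [ln t] only when [ln t >= 1]; the threshold 4 replaces
    [e], since [exp (1/2) <= 2]. *)
Lemma ln_ge1 (t : R) : 4 <= t -> 1 <= ln t.
Proof.
move=> t4; rewrite -ler_expR lnK ?posrE; last by lra.
apply: le_trans t4.
have h : expR (- 2^-1) >= 2^-1 :> R by have := expR_ge1Dx (- 2^-1 : R); lra.
have e0 := expR_gt0 (2^-1 : R).
have : expR (2^-1) * expR (- 2^-1) = 1 :> R by rewrite -expRD subrr expR0.
have -> : expR 1 = expR 2^-1 * expR 2^-1 :> R.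
  by rewrite -expRD; congr expR; lra.
nra.
Qed.

(** Differentiation gains a factor [1/t] each time: every term of the derivative contains
    a derivative of [logomega] or of [ln]. *)
Lemma mask_derivatives_le (r kappa : R) (F : R -> R) (a1 : R) :
  (forall (t : R) (k : nat), 1 <= t -> (k <= 2)%N -> `|derive1n k F t| <= a1) ->
  exists2 C : R, 0 < C & forall t, 4 <= t ->
   [/\ `|log_mask r kappa F t| <= C * omega r kappa t,
       `|dlog_mask r kappa F t| <= C * omega r kappa t / t
     & `|ddlog_mask r kappa F t| <= C * omega r kappa t / t ^+ 2].
Proof.
move=> bF.
pose A := `|r| + 6 * `|kappa|.
have A0 : 0 <= A by rewrite addr_ge0// mulr_ge0.
have a0 : 0 <= a1 by apply: le_trans (bF 1 0%N _ _) => //.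
exists ((A ^+ 2 + 3 * A + 3) * (a1 + 1)); first by rewrite mulr_gt0//; nra.
move=> t t4; have t1 : 1 <= t by lra.
have t0 : 0 < t by lra.
have l1 := ln_ge1 t4.
have F0 := bF _ 0%N l1 isT; have F1 := bF _ 1%N l1 isT; have F2 := bF _ 2%N l1 isT.
rewrite /= in F0 F1.
have w0 := omega_gt0 r kappa t1.
have e0 := expR_ge0 (logomega r kappa t).
rewrite omegaE// in w0 *.
have d1 : `|dlogomega r kappa t| <= A / t.
  apply: le_trans (dlogomega_le _ _ t1) _.
  by rewrite ler_wpM2r ?invr_ge0 ?(ltW t0)// /A lerD2l ler_wpM2r//; lra.
have d2 : `|ddlogomega r kappa t| <= A / t ^+ 2 by exact: ddlogomega_le.
have Bt (B : R) (z : R) : B <= (A ^+ 2 + 3 * A + 3) * (a1 + 1) -> 0 <= z ->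
    expR (logomega r kappa t) * (B * z) <=
    (A ^+ 2 + 3 * A + 3) * (a1 + 1) * expR (logomega r kappa t) * z.
  by move=> hB z0; rewrite mulrCA mulrA ler_wpM2r// ler_wpM2r.
split.
- rewrite /log_mask normrM (ger0_norm e0).
  apply: le_trans (_ : expR (logomega r kappa t) * (a1 * 1) <= _).
    by rewrite mulr1 ler_wpM2l.
  by rewrite -[leRHS]mulr1; apply: Bt => //; nra.
- rewrite /dlog_mask normrM (ger0_norm e0).
  apply: le_trans (Bt ((A + 1) * a1) t^-1 _ _); last 2 first.
  - nra.
  - by rewrite invr_ge0 ltW.
  rewrite ler_wpM2l// (le_trans (ler_normD _ _))//.
  rewrite (_ : (A + 1) * a1 / t = A / t * a1 + a1 / t); last by ring.
  rewrite lerD// normrM; first by rewrite ler_pM.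
  by rewrite normfV (gtr0_norm t0) ler_wpM2r// invr_ge0 ltW.
- rewrite /ddlog_mask normrM (ger0_norm e0).
  apply: le_trans (Bt ((A ^+ 2 + 3 * A + 2) * a1) (t ^+ 2)^-1 _ _); last 2 first.
  - nra.
  - by rewrite invr_ge0 exprn_ge0// ltW.
  have tt0 : 0 <= (t ^+ 2)^-1 by rewrite invr_ge0 exprn_ge0// ltW.
  rewrite ler_wpM2l//.
  have -> : (A ^+ 2 + 3 * A + 2) * a1 / t ^+ 2 =
    ((A / t) ^+ 2 + A / t ^+ 2) * a1 + (2 * (A / t) / t + (t ^+ 2)^-1) * a1
    + a1 / t ^+ 2 by field; lra.
  apply: le_trans (ler_normD _ _) _; apply: lerD; last first.
    by rewrite normrM normfV (ger0_norm (exprn_ge0 _ (ltW t0))) ler_wpM2r.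
  apply: le_trans (ler_normD _ _) _; apply: lerD.
    rewrite normrM; apply: ler_pM => //; rewrite (le_trans (ler_normD _ _))// lerD//.
    by rewrite normrX lerXn2r ?nnegrE// divr_ge0// ltW.
  rewrite normrM; apply: ler_pM => //; rewrite (le_trans (ler_normB _ _))// lerD//.
    rewrite !normrM normfV (gtr0_norm t0) (ger0_norm (x := 2))//.
    by apply: ler_pM; rewrite ?invr_ge0 ?(ltW t0) ?mulr_ge0 ?ler_wpM2l.
  by rewrite ger0_norm.
Qed.

End MaskBounds.

(** * Symbol estimates for masks on the line *)

Section MaskDifferences.
Context {R : realType}.

Lemma omega_near_le (r kappa : R) : 1 < r ->
  exists2 D : R, 0 < D & forall x y : R, 5 <= x -> x - 1 <= y <= x + 1 ->
    omega r kappa y <= D * omega r kappa (1 + x).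
Proof.
move=> r1; have [D D0 HD] := omega_potter kappa r1.
exists (D * 2 `^ ((1 + r) / 2)); first by rewrite mulr_gt0// powR_gt0.
move=> x y x5 /andP[xy yx].
have y1 : 1 <= y by lra.
have s1 : 1 <= 1 + x by lra.
have sy : 1 + x <= 4 * y by lra.
have := HD y (1 + x) y1 s1 sy.
set q := y / _; have q1 : 2^-1 <= q by rewrite ler_pdivlMr; lra.
have qr : q `^ (- ((1 + r) / 2)) <= 2 `^ ((1 + r) / 2).
  have -> : - ((1 + r) / 2) = -1 * ((1 + r) / 2) by ring.
  rewrite (powRrM q (-1)) powR_inv1; last by lra.
  apply: ge0_ler_powR; rewrite ?nnegrE; [lra|by rewrite invr_ge0; lra|lra|].
  by rewrite -[leRHS]invrK lef_pV2 ?posrE ?invr_gt0//; lra.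
move=> /le_trans; apply.
rewrite [leRHS]mulrAC ler_wpM2l//.
by rewrite mulr_ge0 ?(ltW D0)// ltW// omega_gt0.
Qed.

(** Used on the bounded range where the logarithmic form of the mask says nothing: there
    boundedness of the mask is enough, since the target rate is bounded below. *)
Lemma omega_bounded_below (r kappa : R) : 1 < r ->
  exists2 C : R, 0 < C & forall x, 0 <= x -> x <= 5 ->
    1 <= C * omega r kappa (1 + x) / (1 + x) ^+ 2.
Proof.
move=> r1; have [D D0 HD] := omega_potter kappa r1.
have w6 : 0 < omega r kappa 6 by apply: omega_gt0; lra.
exists (36 * D / omega r kappa 6); first by rewrite divr_gt0// mulr_gt0.
move=> x x0 x5.
have s1 : 1 <= 1 + x by lra.
have l1 : 1 <= 6 :> R by lra.
have l2 : 1 + x <= 4 * 6 by lra.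
have := HD 6 (1 + x) l1 s1 l2.
set q := 6 / _; have q1 : 1 <= q by rewrite ler_pdivlMr; lra.
have qr : q `^ (- ((1 + r) / 2)) <= 1.
  by rewrite -[leRHS](powRr0 q) ler_powR//; lra.
have ws := omega_gt0 r kappa s1.
move=> h6; have {}h6 : omega r kappa 6 <= D * omega r kappa (1 + x).
  by apply: le_trans h6 _; rewrite ler_piMr// mulr_ge0// ltW.
rewrite ler_pdivlMr ?mul1r ?exprn_gt0//; last by lra.
rewrite -(ler_pM2r w6).
rewrite (_ : _ / _ * _ * _ = 36 * (D * omega r kappa (1 + x))); last by field; lra.
by apply: ler_pM; [rewrite exprn_ge0//; lra|exact: ltW|nra|].
Qed.

Lemma mask_large_differences_le (r kappa : R) (F : R -> R) (a1 : R) : 1 < r ->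
  twice_derivable F ->
  (forall (t : R) (k : nat), 1 <= t -> (k <= 2)%N -> `|derive1n k F t| <= a1) ->
  exists2 C : R, 0 < C & forall x, 5 <= x ->
   let w := C * omega r kappa (1 + x) in let f := log_mask r kappa F in
   [/\ `|f x| <= w, `|f (x + 1) - f x| <= w / (1 + x),
       `|f (x - 1) - f x| <= w / (1 + x)
     & `|f (x + 1) - 2 * f x + f (x - 1)| <= w / (1 + x) ^+ 2].
Proof.
move=> r1 [dF ddF] bF.
have [D D0 HD] := omega_near_le kappa r1.
have [B B0 HB] := mask_derivatives_le r kappa bF.
have dF' (z : R) : is_derive z 1 F (derive1 F z).
  exact: derivable_is_derive1.
have ddF' (z : R) : is_derive z 1 (derive1 F) (derive1n 2 F z).
  exact: derivable_is_derive1.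
have DB0 : 0 < B * D by rewrite mulr_gt0.
exists (4 * (B * D)); first by rewrite mulr_gt0.
move=> x x5 w f.
pose v := B * D * omega r kappa (1 + x).
have s1 : 1 <= 1 + x by lra.
have v0 : 0 < v by rewrite mulr_gt0// omega_gt0.
have wE : w = 4 * v by rewrite /w /v; ring.
rewrite {}wE.
have is0 : 0 < (1 + x)^-1 by rewrite invr_gt0; lra.
have dom y : x - 1 <= y <= x + 1 -> B * omega r kappa y <= v.
  by move=> yx; rewrite /v -mulrA ler_pM2l//; exact: HD.
have dm y : x - 1 <= y <= x + 1 -> is_derive y 1 f (dlog_mask r kappa F y).
  move=> /andP[xy _]; have y1 : 1 <= y by clear -x5 xy; lra.
  exact: (is_derive_mask r kappa dF' y1).
have ddm y : x - 1 <= y <= x + 1 -> is_derive y 1 (dlog_mask r kappa F) (ddlog_mask r kappa F y).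
  move=> /andP[xy _]; have y1 : 1 <= y by clear -x5 xy; lra.
  exact: (is_derive_dmask r kappa dF' ddF' y1).
have mk y : x - 1 <= y <= x + 1 -> [/\ `|f y| <= v,
    `|dlog_mask r kappa F y| <= 2 * v / (1 + x) &
    `|ddlog_mask r kappa F y| <= 4 * v / (1 + x) ^+ 2].
  move=> xy; have y4 : 4 <= y by case/andP: xy => xy _; clear -xy x5; lra.
  have [B1 B2 B3] := HB y y4.
  have y0 : 0 < y by clear -y4; lra.
  have w0 : 0 <= B * omega r kappa y.
    by rewrite mulr_ge0 ?(ltW B0)// ltW// omega_gt0//; clear -y4; lra.
  have d1 := dom _ xy; have i1 : y^-1 <= 2 * (1 + x)^-1.
    rewrite -[y^-1]mul1r ler_pdivrMr// mulrAC ler_pdivlMr.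
      by case/andP: xy => xy _; clear -xy x5; lra.
    by clear -x5; lra.
  have iy0 : 0 <= y^-1 by rewrite invr_ge0 ltW.
  split.
  - exact: le_trans B1 _.
  - apply: le_trans B2 _.
    rewrite (_ : 2 * v / _ = v * (2 * (1 + x)^-1)); last by ring.
    exact: ler_pM.
  - apply: le_trans B3 _.
    rewrite (_ : 4 * v / _ = v * (2 * (1 + x)^-1) ^+ 2); last by field; clear -x5; lra.
    rewrite -exprVn.
    apply: ler_pM => //; first by rewrite exprn_ge0.
    by rewrite lerXn2r// nnegrE// (le_trans iy0).
have vx : 2 * v / (1 + x) <= 4 * v / (1 + x).
  by rewrite ler_wpM2r ?(ltW is0)// ler_wpM2r ?(ltW v0)// ler_nat.
clearbody v; clear D D0 HD B B0 HB DB0 dom w s1 ddF dF dF' ddF' bF.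
have xx : x - 1 <= x <= x + 1 by clear; lra.
split.
- have [fx _ _] := mk x xx; apply: le_trans fx _.
  by rewrite ler_peMl ?(ltW v0)//; clear; lra.
- apply: le_trans vx.
  have -> : 2 * v / (1 + x) = 2 * v / (1 + x) * (x + 1 - x) by ring.
  have yx y : x <= y <= x + 1 -> x - 1 <= y <= x + 1 by clear; lra.
  apply: (@MVT_le _ _ (dlog_mask r kappa F)); first by clear; lra.
    by move=> y /yx; exact: dm.
  by move=> y /yx /mk[].
- apply: le_trans vx.
  have -> : 2 * v / (1 + x) = 2 * v / (1 + x) * (x - (x - 1)) by ring.
  have yx y : x - 1 <= y <= x -> x - 1 <= y <= x + 1 by clear; lra.
  rewrite distrC; apply: (@MVT_le _ _ (dlog_mask r kappa F)); first by clear; lra.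
    by move=> y /yx; exact: dm.
  by move=> y /yx /mk[].
- have bd y : x - 1 <= y <= x + 1 ->
      `|ddlog_mask r kappa F y| <= 4 * v / (1 + x) ^+ 2 by move=> /mk[].
  have := second_difference_le ltr01 dm ddm bd.
  by rewrite expr1n mulr1.
Qed.

(** Apart from evenness, all that the rest of the proof uses of the mask: it behaves like
    a symbol of order given by [omega]. Near the origin it follows from boundedness, far away
    from the logarithmic form, and on the negative axis from evenness. *)
Lemma mask_differences_le (r kappa : R) (lam : R -> R) : 1 < r ->
  (exists M : R, forall x, `|lam x| <= M) -> is_mask r kappa lam ->
  exists2 C : R, 0 < C & forall x : R,
   let w := C * omega r kappa (1 + `|x|) in
   [/\ `|lam x| <= w, `|lam (x + 1) - lam x| <= w / (1 + `|x|),
       `|lam (x - 1) - lam x| <= w / (1 + `|x|)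
     & `|lam (x + 1) - 2 * lam x + lam (x - 1)| <= w / (1 + `|x|) ^+ 2].
Proof.
move=> r1 [M bM] [ev _ [F [a1 [dF lamE bF]]]].
have M0 : 0 <= M by apply: le_trans (bM 0).
have [C1 C10 HC1] := omega_bounded_below kappa r1.
have [C2 C20 HC2] := mask_large_differences_le kappa r1 dF bF.
have {}lamE t : 1 <= t -> lam t = log_mask r kappa F t.
  move=> t1; rewrite lamE// ger0_norm; last by lra.
  by rewrite /log_mask -omegaE.
exists (4 * M * C1 + C2); first by rewrite ltr_wpDl// !mulr_ge0// ltW.
suff main x : 0 <= x -> let w := (4 * M * C1 + C2) * omega r kappa (1 + `|x|) in
   [/\ `|lam x| <= w, `|lam (x + 1) - lam x| <= w / (1 + `|x|),
       `|lam (x - 1) - lam x| <= w / (1 + `|x|)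
     & `|lam (x + 1) - 2 * lam x + lam (x - 1)| <= w / (1 + `|x|) ^+ 2].
  move=> x; have [x0|x0] := leP 0 x; first exact: main.
  have := main (- x); rewrite oppr_ge0 => /(_ (ltW x0)); rewrite normrN.
  have -> : - x + 1 = - (x - 1) by ring.
  have -> : - x - 1 = - (x + 1) by ring.
  rewrite !ev => -[m1 m2 m3 m4]; split=> //.
  have -> // : lam (x + 1) - 2 * lam x + lam (x - 1) =
    lam (x - 1) - 2 * lam x + lam (x + 1) by ring.
move=> x0; rewrite (ger0_norm x0).
have s1 : 1 <= 1 + x by lra.
have ws := omega_gt0 r kappa s1.
have is0 : 0 < (1 + x)^-1 by rewrite invr_gt0; lra.
have is1 : (1 + x)^-1 <= 1 by rewrite invf_le1; lra.
have is2 : 0 <= ((1 + x) ^+ 2)^-1 by rewrite -exprVn exprn_ge0// ltW.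
have M1 : 0 <= 4 * M * C1 by rewrite !mulr_ge0// ltW.
(* For x >= 5 all points involved are at least 4. *)
have [x5|x5] := leP x 5.
  have key : 4 * M <= 4 * M * C1 * omega r kappa (1 + x) / (1 + x) ^+ 2.
    rewrite (_ : 4 * M * C1 * omega r kappa (1 + x) / (1 + x) ^+ 2 =
      4 * M * (C1 * omega r kappa (1 + x) / (1 + x) ^+ 2)); last by rewrite !mulrA.
    by rewrite ler_peMr ?mulr_ge0// HC1.
  pose w := (4 * M * C1 + C2) * omega r kappa (1 + x).
  have w0 : 0 <= w by rewrite mulr_ge0 ?(ltW ws)// addr_ge0// ltW.
  have k0 : 4 * M <= w / (1 + x) ^+ 2.
    apply: le_trans key _; rewrite ler_wpM2r// ler_wpM2r ?(ltW ws)//.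
    by rewrite lerDl ltW.
  have k1 : w / (1 + x) ^+ 2 <= w / (1 + x).
    by rewrite -exprVn ler_wpM2l// expr2 ler_piMl// ltW.
  have k2 : w / (1 + x) <= w by rewrite ler_piMr.
  have b0 := bM x; have b1 := bM (x + 1); have b2 := bM (x - 1).
  rewrite -/w; clearbody w; clear -b0 b1 b2 k0 k1 k2 M0.
  split.
  - lra.
  - by apply: le_trans (ler_normB _ _) _; lra.
  - by apply: le_trans (ler_normB _ _) _; lra.
  - apply: le_trans k0.
    apply: le_trans (ler_normD _ _) _; apply: le_trans (lerD (ler_normB _ _) (lexx _)) _.
    by rewrite normrM (ger0_norm (x := 2))//; lra.
have x5' := ltW x5.
have [] := HC2 x x5'.
have wle : C2 * omega r kappa (1 + x) <= (4 * M * C1 + C2) * omega r kappa (1 + x).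
  by rewrite ler_wpM2r ?(ltW ws)// lerDr.
have l0 : 1 <= x by clear -x5'; lra.
have l1 : 1 <= x + 1 by clear -x5'; lra.
have l2 : 1 <= x - 1 by clear -x5'; lra.
rewrite !lamE// => m1 m2 m3 m4; split.
- exact: le_trans m1 wle.
- by apply: le_trans m2 _; rewrite ler_wpM2r// ltW.
- by apply: le_trans m3 _; rewrite ler_wpM2r// ltW.
- by apply: le_trans m4 _; rewrite ler_wpM2r.
Qed.

End MaskDifferences.

(** * Differences of the cutoff and of products *)

Section Cutoff.
Context {R : realType}.

Lemma continuous_bounded_segment (f : R -> R) (a : R) : 0 <= a -> continuous f ->
  exists M : R, forall x, - a <= x <= a -> `|f x| <= M.
Proof.
move=> a0 cf.
have aa : - a <= a by lra.
have cnf : {within `[- a, a], continuous (fun x => `|f x|)}.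
  apply: continuous_subspaceT => x; apply: continuous_comp (cf x) _.
  exact: norm_continuous.
have [c _ hc] := EVT_max aa cnf.
by exists `|f c| => x xa; apply: hc; rewrite in_itv.
Qed.

(** Derivatives are bounded on [[-3, 3]] by compactness. If [x] is outside [[-2, 2]] then
    [x] and [x + h], [x - h] all lie where [theta] vanishes, because [h <= 1]. *)
Lemma cutoff_differences_le (theta : R -> R) : cutoff theta ->
  exists2 D : R, 1 <= D & forall x h : R, 0 < h -> h <= 1 ->
    [/\ `|theta x| <= D, `|theta (x + h) - theta x| <= D * h,
        `|theta (x - h) - theta x| <= D * h
      & `|theta (x + h) - 2 * theta x + theta (x - h)| <= D * h ^+ 2].
Proof.
move=> [[[d1 d2] c2] _ t0].
have c0 : continuous theta by move=> x; apply/differentiable_continuous/derivable1_diffP.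
have c1 : continuous (derive1 theta) by move=> x; apply/differentiable_continuous/derivable1_diffP.
have l3 : 0 <= 3 :> R by [].
have [M0 b0] := continuous_bounded_segment l3 c0.
have [M1 b1] := continuous_bounded_segment l3 c1.
have [M2 b2] := continuous_bounded_segment l3 c2.
have p0 : 0 <= M0 by apply: le_trans (b0 0 _) => //; apply/andP; split; clear; lra.
have p1 : 0 <= M1 by apply: le_trans (b1 0 _) => //; apply/andP; split; clear; lra.
have p2 : 0 <= M2 by apply: le_trans (b2 0 _) => //; apply/andP; split; clear; lra.
have e1 (x : R) : is_derive x 1 theta (derive1 theta x) by exact: derivable_is_derive1.
have e2 (x : R) : is_derive x 1 (derive1 theta) (derive1n 2 theta x) by exact: derivable_is_derive1.
pose D := 1 + M0 + M1 + M2.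
exists D; first by rewrite /D; clear -p0 p1 p2; lra.
move=> x h h0 h1.
have D0 : 0 <= D by rewrite /D; clear -p0 p1 p2; lra.
have D1 : M1 * h <= D * h by rewrite ler_wpM2r ?(ltW h0)// /D; clear -p0 p1 p2; lra.
have [/andP[x2 x2']|x2] := boolP (- 2 <= x <= 2).
  have bnd z : x - h <= z <= x + h -> - 3 <= z <= 3.
    by clear -x2 x2' h0 h1; lra.
  split.
  - apply: le_trans (_ : M0 <= _); last by rewrite /D; clear -p0 p1 p2; lra.
    by apply: b0; clear -x2 x2'; lra.
  - apply: le_trans D1; rewrite [in leRHS](_ : h = x + h - x); last by ring.
    apply: (@MVT_le R theta (derive1 theta)); first by clear -h0; lra.
    by move=> y yx; apply: b1; apply: bnd; clear -yx h0; lra.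
  - apply: le_trans D1; rewrite [in leRHS](_ : h = x - (x - h)); last by ring.
    rewrite distrC; apply: (@MVT_le R theta (derive1 theta)); first by clear -h0; lra.
    by move=> y yx; apply: b1; apply: bnd; clear -yx h0; lra.
  - apply: le_trans (_ : M2 * h ^+ 2 <= _); last first.
      by rewrite ler_wpM2r ?exprn_ge0 ?(ltW h0)// /D; clear -p0 p1 p2; lra.
    apply: (second_difference_le h0 (fun y _ => e1 y) (fun y _ => e2 y)).
    by move=> y /bnd; exact: b2.
have out z : x - h <= z <= x + h -> theta z = 0.
  move=> xz; apply: t0 => /andP[z1 z2]; move/negP: x2; apply.
  by clear -z1 z2 xz h0 h1; lra.
have [-> -> ->] : [/\ theta x = 0, theta (x + h) = 0 & theta (x - h) = 0].
  by split; apply: out; clear -h0; lra.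
by rewrite mulr0 !subr0 addr0 normr0 !mulr_ge0 ?exprn_ge0 ?(ltW h0).
Qed.

(** The discrete Leibniz rule. *)
Lemma second_difference_mul_le (a ap am b bp bm M D h : R) :
  `|a| <= M -> `|ap - a| <= M * h -> `|am - a| <= M * h ->
  `|ap - 2 * a + am| <= M * h ^+ 2 ->
  `|b| <= D -> `|bp - b| <= D * h -> `|bm - b| <= D * h ->
  `|bp - 2 * b + bm| <= D * h ^+ 2 ->
  `|ap * bp - 2 * (a * b) + am * bm| <= 4 * (M * D) * h ^+ 2.
Proof.
move=> a0 a1 a2 a3 b0 b1 b2 b3.
have -> : ap * bp - 2 * (a * b) + am * bm =
  a * (bp - 2 * b + bm) + (ap - a) * (bp - b) + (am - a) * (bm - b)
  + (ap - 2 * a + am) * b by ring.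
have -> : 4 * (M * D) * h ^+ 2 = M * (D * h ^+ 2) + M * h * (D * h)
  + M * h * (D * h) + M * h ^+ 2 * D by ring.
apply: le_trans (ler_normD _ _) _; apply: lerD; last by rewrite normrM ler_pM.
apply: le_trans (ler_normD _ _) _; apply: lerD; last by rewrite normrM ler_pM.
by apply: le_trans (ler_normD _ _) _; apply: lerD; rewrite normrM ler_pM.
Qed.

End Cutoff.

(** * Symmetric sums over the integers *)

Section SymmetricSums.
Context {V : zmodType}.
Implicit Types (F G : int -> V).

Definition symsum (n : nat) (F : int -> V) : V := \sum_(j < n.*2.+1) F (j%:Z - n%:Z).

Lemma symsum0 F : symsum 0 F = F 0.
Proof. by rewrite /symsum big_ord_recl big_ord0 addr0 subr0. Qed.

Lemma symsumS n F : symsum n.+1 F = symsum n F + (F n.+1%:Z + F (- n.+1%:Z)).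
Proof.
rewrite /symsum doubleS big_ord_recl big_ord_recr /=.
rewrite [LHS]addrC -addrA; congr (_ + _); last first.
  by congr (F _ + F _); rewrite /bump/=; lia.
by apply: eq_bigr => i _; congr F; rewrite /bump/=; lia.
Qed.

(** Writing the integers as [j + l N] with [N = 2 m + 1] and [|j| <= m]. Truncations at
    [L N + m] are the ones compatible with this decomposition, which is the one that
    sampling at [N] equidistant nodes sees. *)
Lemma symsum_blocks (L m : nat) F :
  symsum (L * m.*2.+1 + m) F =
  symsum L (fun l => symsum m (fun j => F (j + l * m.*2.+1%:Z))).
Proof.
rewrite /symsum.
have -> : (L * m.*2.+1 + m).*2.+1 = (L.*2.+1 * m.*2.+1)%N by lia.
rewrite -(big_mkord xpredT (fun i => F (i%:Z - (L * m.*2.+1 + m)%N%:Z))).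
rewrite -(big_mkord xpredT (fun i : nat => \sum_(j < m.*2.+1)
  F (j%:Z - m%:Z + (i%:Z - L%:Z) * m.*2.+1%:Z))).
elim: (L.*2.+1) => [|k IH]; first by rewrite mul0n !big_geq.
rewrite [RHS]big_nat_recr//= -IH mulSnr (big_cat_nat (n := (k * m.*2.+1)%N))//=; last first.
  by rewrite leq_addr.
congr (_ + _); rewrite -{1}(add0n (k * _)%N) [X in \sum_(_ <= _ < X) _]addnC big_addn addnK big_mkord.
by apply: eq_bigr => i _; congr F; lia.
Qed.

Lemma symsumB n F G : symsum n (fun k => F k - G k) = symsum n F - symsum n G.
Proof. exact: sumrB. Qed.

Lemma eq_symsum n F G : (forall k : int, `|k| <= n%:Z -> F k = G k) ->
  symsum n F = symsum n G.
Proof. by move=> FG; apply: eq_bigr => i _; apply: FG; have := ltn_ord i; lia. Qed.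

End SymmetricSums.

(** * Summation by parts for trigonometric sums *)

Section Expi.
Context {R : realType}.
Implicit Types (x y : R).
Local Open Scope complex_scope.

Lemma expiD x y : expi (x + y) = expi x * expi y.
Proof. by rewrite /expi cosD sinD; apply/eqP; rewrite eq_complex /= !eqxx/= addrC. Qed.

Lemma expi0 : expi 0 = 1 :> R[i].
Proof. by rewrite /expi cos0 sin0. Qed.

Lemma normc_expi x : `|expi x| = 1.
Proof. by rewrite normc_def /= cos2Dsin2 sqrtr1. Qed.

Lemma expiN_add x : expi x + expi (- x) = (2 * cos x)%:C.
Proof. by rewrite /expi cosN sinN; apply/eqP; rewrite eq_complex /= subrr eqxx andbT; apply/eqP; ring. Qed.

Lemma ler_norm_symsum n (F : int -> R[i]) (G : int -> R) :
  (forall k, `|k| <= n%:Z -> `|F k| <= (G k)%:C) ->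
  `|symsum n F| <= (symsum n G)%:C.
Proof.
move=> FG; apply: le_trans (ler_norm_sum _ _ _) _.
rewrite /symsum rmorph_sum/=; apply: ler_sum => i _; apply: FG.
by have := ltn_ord i; lia.
Qed.

Definition trigsum (n : nat) (c : int -> R) (y : R) : R[i] :=
  symsum n (fun k => (c k)%:C * expi (k%:~R * y)).

Definition second_difference (c : int -> R) (k : int) : R :=
  c (k + 1) - 2 * c k + c (k - 1).

(** Multiplication by [2 - 2 cos y] is minus the second difference on the exponentials, and
    the discrete Green identity moves it to the coefficients, at the price of four
    boundary terms. *)
Lemma trigsum_second_difference n c y :
  (2 - 2 * cos y)%:C * trigsum n c y =
  - trigsum n (second_difference c) y
  - ((c n)%:C * expi ((n%:Z + 1)%:~R * y) - (c (n%:Z + 1))%:C * expi (n%:~R * y))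
  + ((c (- n%:Z - 1))%:C * expi ((- n%:Z)%:~R * y)
     - (c (- n%:Z))%:C * expi ((- n%:Z - 1)%:~R * y)).
Proof.
(* The Wronskian of c and the exponentials; its increments telescope. *)
pose w (k : int) := (c k)%:C * expi ((k + 1)%:~R * y) - (c (k + 1))%:C * expi (k%:~R * y).
have key (k : int) : (2 - 2 * cos y)%:C * ((c k)%:C * expi (k%:~R * y)) =
   - ((second_difference c k)%:C * expi (k%:~R * y)) - (w k - w (k - 1)).
  have Ep : expi ((k + 1)%:~R * y) = expi (k%:~R * y) * expi y.
    by rewrite -expiD; congr expi; rewrite intrD mulrDl mul1r.
  have Em : expi ((k - 1)%:~R * y) = expi (k%:~R * y) * expi (- y).
    by rewrite -expiD; congr expi; rewrite intrB mulrBl mul1r.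
  rewrite /w Ep Em subrK rmorphB/= -expiN_add /second_difference.
  rewrite !rmorphD/= rmorphN rmorphM/=.
  have -> : (2 : R)%:C = 2 :> R[i] by rewrite rmorph_nat.
  ring.
rewrite /trigsum mulr_sumr.
under eq_bigr do rewrite key.
rewrite sumrB sumrN -/(symsum n _) -addrA; congr (_ + _).
have -> : \sum_(i < n.*2.+1) (w (i%:Z - n%:Z) - w (i%:Z - n%:Z - 1)) = w n - w (- n%:Z - 1).
  rewrite -(big_mkord xpredT (fun i : nat => w (i%:Z - n%:Z) - w (i%:Z - n%:Z - 1))).
  rewrite (@telescope_sumr_eq _ 0 _ (fun i : nat => w (i%:Z - n%:Z - 1)))//.
    by congr (w _ - w _); lia.
  by move=> i _; congr (w _ - w _); lia.
by rewrite /w subrK opprB; ring.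
Qed.

Lemma trigsum_decay n c y :
  `|(2 - 2 * cos y)%:C * trigsum n c y| <=
  (symsum n (fun k => `|second_difference c k|)
   + (`|c n| + `|c (n%:Z + 1)| + `|c (- n%:Z)| + `|c (- n%:Z - 1)|))%:C.
Proof.
have nE (a : R) x : `|a%:C * expi x| = `|a|%:C.
  by rewrite normrM normc_expi mulr1 normc_def /= expr0n addr0 sqrtr_sqr.
rewrite trigsum_second_difference -!addrA !rmorphD/=.
apply: le_trans (ler_normD _ _) _; rewrite normrN; apply: lerD.
  by apply: ler_norm_symsum => k _; rewrite nE.
apply: le_trans (ler_normD _ _) _; rewrite normrN.
apply: le_trans (lerD (ler_normB _ _) (ler_normB _ _)) _; rewrite !nE.
by rewrite -!addrA lerD2l lerD2l addrC.
Qed.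

End Expi.

(** * Tail sums of powers *)

Section TailSums.
Context {R : realType}.
Implicit Types (a b e rho : R).

Lemma ler_powRN a b e : 0 <= e -> 0 < a -> a <= b -> b `^ (- e) <= a `^ (- e).
Proof.
move=> e0 a0 ab; have b0 : 0 < b by exact: lt_le_trans ab.
rewrite !powRN lef_pV2 ?posrE ?powR_gt0//.
by apply: ge0_ler_powR; rewrite ?nnegrE// ltW.
Qed.

Lemma powR_telescope rho a b : 1 < rho -> 0 < a -> a < b ->
  (rho - 1) * b `^ (- rho) * (b - a) <= a `^ (1 - rho) - b `^ (1 - rho).
Proof.
move=> rho1 a0 ab.
pose df (x : R) := (1 - rho) * x `^ (1 - rho - 1).
have dfx (x : R) : 0 < x -> is_derive x 1 ((@powR R)^~ (1 - rho)) (df x).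
  by move=> x0; exact: is_derive1_powR.
have [||c] := @MVT R ((@powR R)^~ (1 - rho)) df a b ab.
- move=> x; rewrite in_itv/= => /andP[ax _]; apply: dfx; exact: lt_trans ax.
- apply: derivable_within_continuous => x; rewrite in_itv/= => /andP[ax _].
  by have [] := dfx x (lt_le_trans a0 ax).
rewrite in_itv/= => /andP[ac cb]; rewrite /df => E.
have -> : a `^ (1 - rho) - b `^ (1 - rho) = (rho - 1) * c `^ (- rho) * (b - a).
  rewrite -opprB E (_ : 1 - rho - 1 = - rho); [ring|ring].
rewrite ler_wpM2r ?subr_ge0 ?(ltW ab)// ler_wpM2l ?subr_ge0 ?(ltW rho1)//.
by apply: ler_powRN; [clear -rho1; lra|exact: lt_trans ac|exact: ltW].
Qed.

(** The power decay from the Potter bound, restricted to [s >= m / 2]. With [s = 1 + |k|]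
    this contains every [k] at which a coefficient of [f - V_m f], or its second difference,
    can be nonzero. *)
Definition tail_weight (rho : R) (m : nat) (s : R) : R :=
  if m%:R <= 2 * s then (s / m%:R) `^ (- rho) else 0.

Lemma tail_weight_ge0 rho m s : 0 <= tail_weight rho m s.
Proof. by rewrite /tail_weight; case: ifP => // _; exact: powR_ge0. Qed.

(** Comparison with an integral, in telescoped form. *)
Lemma tail_weight_sum rho : 1 < rho ->
  exists2 S : R, 0 < S & forall m n : nat, (0 < m)%N ->
    \sum_(i < n) tail_weight rho m i.+1%:R <= S * m%:R.
Proof.
move=> rho1.
have c0 : 0 < (rho - 1)^-1 by rewrite invr_gt0 subr_gt0.
have p0 : 0 < 2 `^ rho :> R by rewrite powR_gt0.
pose S := 2 `^ rho * (1 + (rho - 1)^-1).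
have S0 : 0 < S by rewrite mulr_gt0// addr_gt0.
exists S => // m n m0.
have mR : 1 <= m%:R :> R by rewrite ler1n.
have mR0 : 0 < m%:R :> R by rewrite ltr0n.
(* g k is m ^ rho times a primitive of x ^ (- rho) at k, up to sign; the claim is
   that S m - g n dominates the partial sum as soon as n enters the support. *)
pose g (k : nat) := m%:R * (k%:R / m%:R) `^ (1 - rho) / (rho - 1).
have g0 k : 0 <= g k.
  by rewrite /g mulr_ge0 ?(ltW c0)// mulr_ge0 ?powR_ge0// ltW.
suff : \sum_(i < n) tail_weight rho m i.+1%:R <=
    if (0 < n)%N && (m <= n.*2)%N then S * m%:R - g n else 0.
  case: ifP => _ /le_trans; apply; first by rewrite gerBl.
  by rewrite mulr_ge0 ?(ltW S0)// ltW.
have c2 (k : nat) : (m%:R <= 2 * k%:R :> R) = (m <= k.*2)%N.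
  by rewrite -natrM ler_nat mul2n.
elim: n => [|n IH]; first by rewrite big_ord0.
rewrite big_ord_recr/= {2}/tail_weight c2.
have [mn|mn] := boolP (m <= n.+1.*2)%N; last first.
  rewrite addr0; apply: le_trans IH _.
  by rewrite (_ : (m <= n.*2)%N = false) ?andbF//; clear -mn; lia.
have [nn|nn] := boolP ((0 < n)%N && (m <= n.*2)%N); last first.
  have {}IH : \sum_(i < n) tail_weight rho m i.+1%:R <= 0 by move: IH; rewrite (negbTE nn).
  have u2 : 2^-1 <= n.+1%:R / m%:R :> R.
    rewrite ler_pdivlMr// mulrC ler_pdivrMr// -natrM ler_nat.
    by clear -mn; lia.
  have t1 : (n.+1%:R / m%:R) `^ (- rho) <= 2 `^ rho :> R.
    rewrite (_ : 2 `^ rho = 2^-1 `^ (- rho)); last first.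
      by rewrite -[in RHS]powR_inv1// -powRrM mulrNN mul1r.
    by apply: ler_powRN => //; clear -rho1; lra.
  have t2 : (n.+1%:R / m%:R) `^ (1 - rho) <= 2 `^ rho :> R.
    rewrite (_ : 1 - rho = - (rho - 1)); last by ring.
    apply: (@le_trans _ _ (2^-1 `^ (- (rho - 1)))).
      by apply: ler_powRN => //; clear -rho1; lra.
    rewrite -[in leLHS]powR_inv1// -powRrM mulrNN mul1r.
    by rewrite ler_powR ?ler1n//; clear; lra.
  apply: le_trans (lerD IH t1) _; rewrite add0r.
  have G : g n.+1 <= m%:R * 2 `^ rho / (rho - 1).
    by rewrite /g ler_wpM2r ?(ltW c0)// ler_wpM2l// ltW.
  apply: (@le_trans _ _ (S * m%:R - m%:R * 2 `^ rho / (rho - 1))); last first.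
    by rewrite lerD2l lerN2.
  have -> : S * m%:R - m%:R * 2 `^ rho / (rho - 1) = 2 `^ rho * m%:R.
    by rewrite /S; ring.
  by rewrite ler_peMr// ltW.
have /andP[n0 _] := nn.
rewrite nn in IH; apply: le_trans (lerD IH (lexx _)) _.
rewrite -addrA lerD2l.
have nR0 : 0 < n%:R / m%:R :> R by rewrite divr_gt0// ltr0n.
have nn1 : n%:R / m%:R < n.+1%:R / m%:R :> R by rewrite ltr_pM2r ?invr_gt0// ltr_nat.
have := powR_telescope rho1 nR0 nn1.
have -> : n.+1%:R / m%:R - n%:R / m%:R = m%:R^-1 :> R.
  by rewrite -mulrBl -natrB// subSnn mul1r.
rewrite -(ler_pM2l mR0) -(ler_pM2r c0) => h.
have E1 : m%:R * ((rho - 1) * (n.+1%:R / m%:R) `^ (- rho) / m%:R) / (rho - 1) =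
   (n.+1%:R / m%:R) `^ (- rho) :> R.
  by field; rewrite subr_eq0 !gt_eqF.
rewrite E1 in h; rewrite -lerBrDl; apply: le_trans h _.
by rewrite /g; rewrite le_eqVlt; apply/orP; left; apply/eqP; ring.
Qed.

End TailSums.

(** * Fejer-type domination *)

Section KernelBounds.
Context {R : realType}.
Implicit Types (x y s t : R) (m n : nat).
Local Open Scope complex_scope.

(** Up to a constant, a bump of height [m] and width [1 / m]. *)
Definition fejer_weight m y : R := m%:R / (1 + m%:R ^+ 2 * (2 - 2 * cos y)).

Lemma fejer_denom_ge1 m y : 1 <= 1 + m%:R ^+ 2 * (2 - 2 * cos y).
Proof. by rewrite lerDl mulr_ge0 ?exprn_ge0// subr_ge0; have := cos_le1 y; lra. Qed.

Lemma fejer_weight_ge0 m y : 0 <= fejer_weight m y.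
Proof. by rewrite divr_ge0// (le_trans _ (fejer_denom_ge1 m y)). Qed.

(** A pointwise bound by [m] and a bound by [1 / m] after multiplication by
    [2 - 2 cos y] together say that [z] is dominated by the Fejer weight. *)
Lemma fejer_domination m y (z : R[i]) (a b : R) :
  `|z| <= (a * m%:R)%:C -> m%:R * `|(2 - 2 * cos y)%:C * z| <= b%:C ->
  `|z| <= ((a + b) * fejer_weight m y)%:C.
Proof.
move=> za zb.
have d1 := fejer_denom_ge1 m y.
have d0 : 0 < 1 + m%:R ^+ 2 * (2 - 2 * cos y) by exact: lt_le_trans d1.
have c0 : 0 <= 2 - 2 * cos y by have := cos_le1 y; lra.
have nz : `|z| = (Normc.normc z)%:C by [].
move: za zb; rewrite normrM nz.
have -> : `|(2 - 2 * cos y)%:C| = (2 - 2 * cos y)%:C by rewrite ger0_norm// lecR.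
have -> : (m%:R : R[i]) = (m%:R : R)%:C by rewrite rmorph_nat.
rewrite -!rmorphM/= !lecR => za zb.
rewrite /fejer_weight mulrA ler_pdivlMr// mulrDr mulr1 [leRHS]mulrDl lerD//.
have -> : Normc.normc z * (m%:R ^+ 2 * (2 - 2 * cos y)) =
  m%:R * ((2 - 2 * cos y) * Normc.normc z) * m%:R by ring.
by rewrite ler_wpM2r.
Qed.

Lemma normc_trigsum n (c : int -> R) y : `|trigsum n c y| <= (symsum n (fun k => `|c k|))%:C.
Proof.
apply: ler_norm_symsum => k _.
by rewrite normrM normc_expi mulr1 normc_def /= expr0n addr0 sqrtr_sqr.
Qed.

Lemma ler_symsum n (F G : int -> R) :
  (forall k, `|k| <= n%:Z -> F k <= G k) -> symsum n F <= symsum n G.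
Proof. by move=> FG; apply: ler_sum => i _; apply: FG; have := ltn_ord i; lia. Qed.

Lemma symsum_cst n (a : R) : symsum n (fun _ => a) = n.*2.+1%:R * a.
Proof. by rewrite /symsum sumr_const card_ord mulr_natl. Qed.

Lemma symsum_mull n (a : R) F : symsum n (fun k => a * F k) = a * symsum n F.
Proof. by rewrite /symsum mulr_sumr. Qed.

Lemma symsum_tail_weight rho m n :
  symsum n (fun k => tail_weight rho m (1 + `|k%:~R| : R)) <=
  2 * \sum_(i < n.+1) tail_weight rho m (i.+1%:R : R).
Proof.
have w0 i : 0 <= tail_weight rho m (i%:R : R) by exact: tail_weight_ge0.
elim: n => [|n IH].
  rewrite symsum0 big_ord_recl big_ord0 mulr0z normr0 !addr0.
  by apply: ler_peMl; [exact: (w0 1%N)|rewrite ler1n].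
rewrite symsumS big_ord_recr/= mulrDr lerD//.
by rewrite mulrNz normrN normr_nat nat1r [leRHS]mulr_natl mulr2n.
Qed.

End KernelBounds.

(** * Coefficients of the high-frequency and aliasing parts *)

Section KernelEstimates.
Context {R : realType}.
Local Open Scope complex_scope.

(** The coefficients of [f - V_m f] when [g] is a Dirac mass. *)
Definition high_coef (theta lam : R -> R) (m : nat) (k : int) : R :=
  lam k%:~R * (1 - theta (k%:~R / m%:R)).

(** Sampling sends the frequency [j] also to [j + l N]; these are the coefficients of
    the copy number [l]. *)
Definition alias_coef (theta lam : R -> R) (m : nat) (l j : int) : R :=
  lam (j + l * m.*2.+1%:Z)%:~R * theta (j%:~R / m%:R).

(** For [2 (1 + |k|) < m] the cutoff equals 1 at [k] and at both neighbours, so everything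
    vanishes. Otherwise the mask and the cutoff both lose a factor [O(1/m)] per difference,
    and the discrete Leibniz rule applies. *)
Lemma high_coef_le (theta lam : R -> R) (r kappa : R) :
  cutoff theta -> 1 < r -> (exists M : R, forall x, `|lam x| <= M) ->
  is_mask r kappa lam ->
  exists2 A : R, 0 < A & forall (m : nat) (k : int), (0 < m)%N ->
  let w := A * omega r kappa m%:R * tail_weight ((1 + r) / 2) m (1 + `|k%:~R|) in
  `|high_coef theta lam m k| <= w /\ m%:R ^+ 2 * `|second_difference (high_coef theta lam m) k| <= w.
Proof.
move=> htheta hr hlamb hlam.
pose rho := (1 + r) / 2; pose om (m : nat) := omega r kappa m%:R.
have [C C0 HC] := mask_differences_le hr hlamb hlam.
have [D D1 HD] := cutoff_differences_le htheta.
have [P P0 HP] := omega_potter kappa hr.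
have D0 : 0 < D by exact: lt_le_trans D1.
have [_ th1 _] := htheta.
exists (16 * (C * P * (D + 1))); first by rewrite !mulr_gt0// addr_gt0.
move=> m k m0; rewrite /tail_weight.
have mR0 : 0 < m%:R :> R by rewrite ltr0n.
have mR1 : 1 <= m%:R :> R by rewrite ler1n.
set x : R := k%:~R.
have kp : (k + 1)%:~R = x + 1 :> R by rewrite intrD.
have km : (k - 1)%:~R = x - 1 :> R by rewrite intrB.
have um0 : 0 < m%:R^-1 :> R by rewrite invr_gt0.
have um1 : m%:R^-1 <= 1 :> R by rewrite invf_le1.
have Ep : (x + 1) / m%:R = x / m%:R + m%:R^-1 by rewrite mulrDl mul1r.
have Em : (x - 1) / m%:R = x / m%:R - m%:R^-1 by rewrite mulrBl mul1r.
case: ifP => [xm|/negbT]; last first.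
  rewrite -ltNge => xm; rewrite mulr0.
  have t1 z : `|z| <= 1 + `|x| -> theta (z / m%:R) = 1.
    move=> zx; apply: th1; rewrite -ler_norml normrM normfV (gtr0_norm mR0).
    by rewrite ler_pdivrMr//; clear -zx xm; lra.
  have z0 : high_coef theta lam m k = 0 by rewrite /high_coef t1 ?subrr ?mulr0// lerDr.
  have zp : high_coef theta lam m (k + 1) = 0.
    by rewrite /high_coef t1 ?subrr ?mulr0// kp addrC (le_trans (ler_normD _ _))// normr1.
  have zm : high_coef theta lam m (k - 1) = 0.
    by rewrite /high_coef t1 ?subrr ?mulr0// km addrC (le_trans (ler_normD _ _))// normrN1.
  by rewrite /second_difference z0 zp zm mulr0 subr0 addr0 normr0 mulr0.
have s1 : 1 <= 1 + `|x| by rewrite lerDl.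
have s0 : 0 < 1 + `|x| by exact: lt_le_trans s1.
have ms : m%:R <= 4 * (1 + `|x|) by clear -xm s0; lra.
set T := ((1 + `|x|) / m%:R) `^ (- rho).
have T0 : 0 <= T by exact: powR_ge0.
have om0 : 0 < om m by exact: omega_gt0.
pose M := C * (P * om m * T).
have M0 : 0 <= M by rewrite mulr_ge0 ?(ltW C0)// mulr_ge0// mulr_ge0 ?(ltW P0)// ltW.
have CM : C * omega r kappa (1 + `|x|) <= M.
  by rewrite ler_wpM2l ?(ltW C0)//; exact: HP.
(* On the support, 1 / (1 + |k|) and 1 / m are both at most h. *)
pose h : R := 2 / m%:R.
have h0 : 0 < h by rewrite divr_gt0.
have xh : (1 + `|x|)^-1 <= h.
  by rewrite -[leLHS]mul1r ler_pdivrMr// mulrAC ler_pdivlMr// mul1r.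
have uh : m%:R^-1 <= h by rewrite /h ler_peMl ?(ltW um0)// ler1n.
have i0 : 0 <= (1 + `|x|)^-1 by rewrite invr_ge0 ltW.
have w0 : 0 <= C * omega r kappa (1 + `|x|).
  by rewrite mulr_ge0 ?(ltW C0)// ltW// omega_gt0.
have [l0 l1 l2 l3] := HC x.
have [t0 t1 t2 t3] := HD (x / m%:R) _ um0 um1.
have {}l0 := le_trans l0 CM.
have {}l1 : `|lam (x + 1) - lam x| <= M * h by apply: le_trans l1 _; exact: ler_pM.
have {}l2 : `|lam (x - 1) - lam x| <= M * h by apply: le_trans l2 _; exact: ler_pM.
have {}l3 : `|lam (x + 1) - 2 * lam x + lam (x - 1)| <= M * h ^+ 2.
  apply: le_trans l3 _; rewrite -exprVn; apply: ler_pM; rewrite ?exprn_ge0 ?CM//.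
  by rewrite lerXn2r// nnegrE// ltW.
have D10 : 0 <= D + 1 by rewrite addr_ge0// ltW.
have DD : D <= D + 1 by rewrite lerDl.
have {}t0 : `|1 - theta (x / m%:R)| <= D + 1.
  by rewrite (le_trans (ler_normB _ _))// normr1 addrC lerD2r.
have {}t1 : `|(1 - theta (x / m%:R + m%:R^-1)) - (1 - theta (x / m%:R))| <= (D + 1) * h.
  rewrite (_ : _ - _ = - (theta (x / m%:R + m%:R^-1) - theta (x / m%:R))); last by ring.
  by rewrite normrN; apply: le_trans t1 _; apply: ler_pM => //; exact: ltW.
have {}t2 : `|(1 - theta (x / m%:R - m%:R^-1)) - (1 - theta (x / m%:R))| <= (D + 1) * h.
  rewrite (_ : _ - _ = - (theta (x / m%:R - m%:R^-1) - theta (x / m%:R))); last by ring.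
  by rewrite normrN; apply: le_trans t2 _; apply: ler_pM => //; exact: ltW.
have {}t3 : `|(1 - theta (x / m%:R + m%:R^-1)) - 2 * (1 - theta (x / m%:R))
    + (1 - theta (x / m%:R - m%:R^-1))| <= (D + 1) * h ^+ 2.
  rewrite (_ : _ + _ = - (theta (x / m%:R + m%:R^-1) - 2 * theta (x / m%:R)
    + theta (x / m%:R - m%:R^-1))); last by ring.
  rewrite normrN; apply: le_trans t3 _; apply: ler_pM => //; rewrite ?exprn_ge0 ?(ltW um0) ?(ltW D0)//.
  by rewrite lerXn2r// nnegrE ltW.
have w16 : 16 * (M * (D + 1)) <= 16 * (C * P * (D + 1)) * om m * T.
  by rewrite le_eqVlt; apply/orP; left; apply/eqP; rewrite /M; ring.
split.
  apply: le_trans w16; rewrite /high_coef normrM.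
  apply: le_trans (ler_pM _ _ l0 t0) _ => //.
  by apply: ler_peMl; [exact: mulr_ge0 M0 D10|rewrite ler1n].
apply: le_trans w16; rewrite /second_difference /high_coef kp km Ep Em.
have := second_difference_mul_le l0 l1 l2 l3 t0 t1 t2 t3.
rewrite -(ler_pM2l (exprn_gt0 2 mR0)) => /le_trans; apply.
by rewrite le_eqVlt; apply/orP; left; apply/eqP; rewrite /h; field; rewrite gt_eqF.
Qed.

(** For [|j| <= m] the frequency [j + l N] has size at least [m |l|], so the bound
    on the mask there is, up to a constant, [omega(m)] times the summable factor
    [|l| ^ (- (1 + r) / 2)]. *)
Lemma alias_coef_le (theta lam : R -> R) (r kappa : R) :
  cutoff theta -> 1 < r -> (exists M : R, forall x, `|lam x| <= M) ->
  is_mask r kappa lam ->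
  exists2 A : R, 0 < A & forall (m : nat) (l j : int), (0 < m)%N ->
  l != 0 -> `|j| <= m%:Z ->
  let w := A * omega r kappa m%:R * `|l|%:~R `^ (- ((1 + r) / 2)) in
  `|alias_coef theta lam m l j| <= w /\ m%:R ^+ 2 * `|second_difference (alias_coef theta lam m l) j| <= w.
Proof.
move=> htheta hr hlamb hlam.
pose rho := (1 + r) / 2; pose om (m : nat) := omega r kappa m%:R.
have [C C0 HC] := mask_differences_le hr hlamb hlam.
have [D D1 HD] := cutoff_differences_le htheta.
have [P P0 HP] := omega_potter kappa hr.
have D0 : 0 < D by exact: lt_le_trans D1.
exists (4 * (C * P * D)); first by rewrite !mulr_gt0.
move=> m l j m0 l0 jm.
have mR0 : 0 < m%:R :> R by rewrite ltr0n.
have mR1 : 1 <= m%:R :> R by rewrite ler1n.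
set x : R := (j + l * m.*2.+1%:Z)%:~R.
set u : R := j%:~R.
have kp : (j + 1 + l * m.*2.+1%:Z)%:~R = x + 1 :> R by rewrite addrAC intrD.
have km : (j - 1 + l * m.*2.+1%:Z)%:~R = x - 1 :> R by rewrite addrAC intrB.
have up : (j + 1)%:~R = u + 1 :> R by rewrite intrD.
have um : (j - 1)%:~R = u - 1 :> R by rewrite intrB.
have um0 : 0 < m%:R^-1 :> R by rewrite invr_gt0.
have um1 : m%:R^-1 <= 1 :> R by rewrite invf_le1.
have Ep : (u + 1) / m%:R = u / m%:R + m%:R^-1 by rewrite mulrDl mul1r.
have Em : (u - 1) / m%:R = u / m%:R - m%:R^-1 by rewrite mulrBl mul1r.
have l1R : 1 <= `|l|%:~R :> R by rewrite (ler_int R 1); clear -l0; lia.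
have xml : m%:R * `|l|%:~R <= 1 + `|x|.
  have h : (m%:Z * `|l| <= 1 + `|j + l * m.*2.+1%:Z|) by clear -jm l0 m0; nia.
  by move: h; rewrite -(ler_int R) intrM intrD (intr_norm _ (j + l * m.*2.+1%:Z)).
have xm : m%:R <= 1 + `|x| by apply: le_trans xml; rewrite ler_peMr// ltW.
have s1 : 1 <= 1 + `|x| by rewrite lerDl.
have s0 : 0 < 1 + `|x| by exact: lt_le_trans s1.
have ms : m%:R <= 4 * (1 + `|x|) by clear -xm s0; lra.
set T := `|l|%:~R `^ (- rho).
have T0 : 0 <= T by exact: powR_ge0.
have om0 : 0 < om m by exact: omega_gt0.
have hrho : 0 <= rho by rewrite /rho; clear -hr; lra.
have TT : ((1 + `|x|) / m%:R) `^ (- rho) <= T.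
  apply: ler_powRN => //; first exact: lt_le_trans l1R.
  by rewrite ler_pdivlMr// mulrC.
pose M := C * (P * om m * T).
have M0 : 0 <= M by rewrite mulr_ge0 ?(ltW C0)// mulr_ge0// mulr_ge0 ?(ltW P0)// ltW.
have CM : C * omega r kappa (1 + `|x|) <= M.
  rewrite ler_wpM2l ?(ltW C0)//; apply: le_trans (HP _ _ s1 mR1 ms) _.
  by rewrite ler_wpM2l// mulr_ge0 ?(ltW P0)// ltW.
pose h : R := m%:R^-1.
have h0 : 0 < h by [].
have xh : (1 + `|x|)^-1 <= h by rewrite lef_pV2.
have i0 : 0 <= (1 + `|x|)^-1 by rewrite invr_ge0 ltW.
have w0 : 0 <= C * omega r kappa (1 + `|x|).
  by rewrite mulr_ge0 ?(ltW C0)// ltW// omega_gt0.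
have [b0 b1 b2 b3] := HC x.
have [t0 t1 t2 t3] := HD (u / m%:R) _ um0 um1.
have {}b0 := le_trans b0 CM.
have {}b1 : `|lam (x + 1) - lam x| <= M * h by apply: le_trans b1 _; exact: ler_pM.
have {}b2 : `|lam (x - 1) - lam x| <= M * h by apply: le_trans b2 _; exact: ler_pM.
have {}b3 : `|lam (x + 1) - 2 * lam x + lam (x - 1)| <= M * h ^+ 2.
  apply: le_trans b3 _; rewrite -exprVn; apply: ler_pM; rewrite ?exprn_ge0 ?CM//.
  by rewrite lerXn2r// nnegrE// ltW.
have w4 : 4 * (M * D) = 4 * (C * P * D) * om m * T by rewrite /M; ring.
rewrite /= -w4; split.
  rewrite /alias_coef normrM.
  apply: le_trans (ler_pM _ _ b0 t0) _ => //.
  by apply: ler_peMl; [exact: mulr_ge0 M0 (ltW D0)|rewrite ler1n].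
rewrite /second_difference /alias_coef kp km up um Ep Em.
have := second_difference_mul_le b0 b1 b2 b3 t0 t1 t2 t3.
rewrite -(ler_pM2l (exprn_gt0 2 mR0)) => /le_trans; apply.
by rewrite le_eqVlt; apply/orP; left; apply/eqP; rewrite /h; field; rewrite gt_eqF.
Qed.

End KernelEstimates.

(** * Bound on the truncated error kernel *)

Section ErrorKernelBound.
Context {R : realType}.
Local Open Scope complex_scope.

(** Makes the boundary terms in the summation by parts harmless once the truncation is
    at least [m ^ 2]. *)
Lemma tail_weight_le_inv (e : R) (m : nat) (s : R) : 1 <= e -> (0 < m)%N ->
  m%:R ^+ 2 <= s -> m%:R * tail_weight e m s <= 1.
Proof.
move=> e1 m0 ms; have mR1 : 1 <= m%:R :> R by rewrite ler1n.
have mR0 : 0 < m%:R :> R by rewrite ltr0n.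
rewrite /tail_weight; case: ifP => _; last by rewrite mulr0.
have sm : m%:R <= s / m%:R by rewrite ler_pdivlMr// -expr2.
have : (s / m%:R) `^ (- e) <= m%:R^-1.
  apply: (@le_trans _ _ (m%:R `^ (- e))).
    by apply: ler_powRN => //; rewrite (le_trans ler01).
  by rewrite -powR_inv1 ?ler0n// ler_powR// lerN2.
by rewrite -(ler_pM2l mR0) mulfV ?gt_eqF.
Qed.

Lemma high_kernel_le (theta lam : R -> R) (r kappa : R) :
  cutoff theta -> 1 < r -> (exists M : R, forall x, `|lam x| <= M) ->
  is_mask r kappa lam ->
  exists2 A : R, 0 < A & forall (m n : nat) (y : R), (0 < m)%N -> (m ^ 2 <= n)%N ->
    `|trigsum n (high_coef theta lam m) y| <=
      (A * omega r kappa m%:R * fejer_weight m y)%:C.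
Proof.
move=> htheta hr hlamb hlam.
have [A A0 HA] := high_coef_le htheta hr hlamb hlam.
have rho1 : 1 < (1 + r) / 2 by lra.
have [S S0 HS] := tail_weight_sum rho1.
exists (A * (4 * S + 4)); first by rewrite mulr_gt0// addr_gt0// mulr_gt0.
move=> m n y m0 mn.
have mR1 : 1 <= m%:R :> R by rewrite ler1n.
have mR0 : 0 < m%:R :> R by rewrite ltr0n.
set w := omega r kappa m%:R.
have w0 : 0 < w by exact: omega_gt0.
have Aw : 0 <= A * w by rewrite mulr_ge0 ?(ltW A0) ?(ltW w0).
have tails : A * w * symsum n (fun k => tail_weight ((1 + r) / 2) m (1 + `|k%:~R|)) <=
    A * w * (2 * S) * m%:R.
  rewrite -[leRHS]mulrA ler_wpM2l//; apply: le_trans (symsum_tail_weight _ _ _) _.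
  by rewrite -mulrA ler_wpM2l//; exact: HS.
have -> : A * (4 * S + 4) * w = A * w * (2 * S) + A * w * (2 * S + 4) by ring.
apply: fejer_domination.
  apply: le_trans (normc_trigsum _ _ _) _; rewrite lecR.
  apply: le_trans tails; rewrite -symsum_mull; apply: ler_symsum => k _.
  by case: (HA m k m0).
have -> : (m%:R : R[i]) = (m%:R : R)%:C by rewrite rmorph_nat.
apply: le_trans (ler_wpM2l _ (trigsum_decay _ _ _)) _; first by rewrite lecR.
rewrite -rmorphM lecR [leLHS]mulrDr [leRHS]mulrDr lerD//.
  rewrite -(ler_pM2l mR0) [leLHS]mulrA -expr2 -symsum_mull [leRHS]mulrC.
  apply: le_trans tails; rewrite -symsum_mull; apply: ler_symsum => k _.
  by case: (HA m k m0).
have bd (k : int) : n%:Z <= `|k| -> m%:R * `|high_coef theta lam m k| <= A * w.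
  move=> nk; have [hk _] := HA m k m0.
  apply: le_trans (ler_wpM2l (ltW mR0) hk) _.
  rewrite mulrCA ler_piMr//; apply: tail_weight_le_inv => //; first exact: ltW.
  apply: (@le_trans _ _ `|k|%:~R).
    rewrite -natrX -[_%:R]/((m ^ 2)%N%:Z%:~R) ler_int (le_trans _ nk)//; clear -mn; lia.
  by rewrite intr_norm lerDr.
have -> : A * w * 4 = A * w + A * w + A * w + A * w by ring.
rewrite !mulrDr.
by do 3?[apply: lerD]; apply: bd; clear; lia.
Qed.

(** No boundary terms arise, as the cutoff vanishes at [m] and [m + 1] in absolute
    value. *)
Lemma alias_kernel_le (theta lam : R -> R) (r kappa : R) :
  cutoff theta -> 1 < r -> (exists M : R, forall x, `|lam x| <= M) ->
  is_mask r kappa lam ->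
  exists2 A : R, 0 < A & forall (m : nat) (l : int) (y : R), (0 < m)%N -> l != 0 ->
    `|trigsum m (alias_coef theta lam m l) y| <=
      (A * omega r kappa m%:R * `|l|%:~R `^ (- ((1 + r) / 2)) * fejer_weight m y)%:C.
Proof.
move=> htheta hr hlamb hlam.
have [A A0 HA] := alias_coef_le htheta hr hlamb hlam.
exists (A * 6); first by rewrite mulr_gt0.
move=> m l y m0 l0.
have mR1 : 1 <= m%:R :> R by rewrite ler1n.
have mR0 : 0 < m%:R :> R by rewrite ltr0n.
set w := omega r kappa m%:R; set T := _ `^ _.
have w0 : 0 < w by exact: omega_gt0.
have T0 : 0 <= T by exact: powR_ge0.
have AT : 0 <= A * w * T by rewrite mulr_ge0// mulr_ge0 ?(ltW A0) ?(ltW w0).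
have m3 : m.*2.+1%:R <= 3 * m%:R :> R by rewrite -natrM ler_nat; clear -m0; lia.
have -> : A * 6 * w * T = A * w * T * 3 + A * w * T * 3 by ring.
apply: fejer_domination.
  apply: le_trans (normc_trigsum _ _ _) _; rewrite lecR.
  apply: (@le_trans _ _ (symsum m (fun _ => A * w * T))).
    by apply: ler_symsum => k km; case: (HA m l k m0 l0 km).
  by rewrite symsum_cst [leLHS]mulrC -[leRHS]mulrA ler_wpM2l.
have -> : (m%:R : R[i]) = (m%:R : R)%:C by rewrite rmorph_nat.
apply: le_trans (ler_wpM2l _ (trigsum_decay _ _ _)) _; first by rewrite lecR.
have [_ _ th0] := htheta.
have z (k : int) : m%:Z <= `|k| -> alias_coef theta lam m l k = 0.
  move=> mk; rewrite /alias_coef th0 ?mulr0// => /andP[k1 k2].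
  have : `|k%:~R / m%:R : R| < 1 by rewrite ltr_norml k1.
  rewrite normrM normfV (gtr0_norm mR0) ltr_pdivrMr// mul1r -intr_norm.
  by rewrite -[m%:R]/(m%:Z%:~R) ltr_int ltNge mk.
rewrite !z ?normr0 ?addr0; try by clear; lia.
rewrite -rmorphM lecR -(ler_pM2l mR0) [leLHS]mulrA -expr2 -symsum_mull.
apply: (@le_trans _ _ (symsum m (fun _ => A * w * T))).
  by apply: ler_symsum => k km; case: (HA m l k m0 l0 km).
by rewrite symsum_cst [leLHS]mulrC [leRHS]mulrC -[leRHS]mulrA ler_wpM2l.
Qed.

(** The error kernel with the series for [phi] truncated at [L N + m]: the part of
    [f] above the cutoff, minus the nontrivial aliases. *)
Definition partial_kernel (theta lam : R -> R) (m L : nat) (x t : R) : R[i] :=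
  trigsum (L * m.*2.+1 + m) (high_coef theta lam m) (x - t) -
  symsum L (fun l => if l == 0 then 0 else
    expi ((l * m.*2.+1%:Z)%:~R * x) * trigsum m (alias_coef theta lam m l) (x - t)).

Lemma symsum_powRN (rho : R) : 1 < rho -> exists2 S : R, 0 < S & forall L : nat,
  symsum L (fun l : int => if l == 0 then 0 else `|l|%:~R `^ (- rho)) <= S.
Proof.
move=> rho1; have [S S0 HS] := tail_weight_sum rho1.
exists (2 * S); first by rewrite mulr_gt0.
move=> L; have := HS 1%N L isT; rewrite mulr1 -(ler_pM2l (ltr0n R 2)) => /(le_trans _); apply.
elim: L => [|L IH]; first by rewrite symsum0 eqxx big_ord0 mulr0.
rewrite symsumS big_ord_recr/= mulrDr lerD//.
rewrite normrN /tail_weight divr1 -natrM ler1n/=.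
by rewrite mulr_natl mulr2n.
Qed.

(** For [L >= m] the truncation exceeds [m ^ 2], as needed for the high-frequency part;
    the aliases are summed using [r > 1]. *)
Lemma partial_kernel_le (theta lam : R -> R) (r kappa : R) :
  cutoff theta -> 1 < r -> (exists M : R, forall x, `|lam x| <= M) ->
  is_mask r kappa lam ->
  exists2 A : R, 0 < A & forall (m L : nat) (x t : R), (0 < m)%N -> (m <= L)%N ->
    `|partial_kernel theta lam m L x t| <=
      (A * omega r kappa m%:R * fejer_weight m (x - t))%:C.
Proof.
move=> htheta hr hlamb hlam.
have [A A0 HA] := high_kernel_le htheta hr hlamb hlam.
have [B B0 HB] := alias_kernel_le htheta hr hlamb hlam.
have rho1 : 1 < (1 + r) / 2 by lra.
have [S S0 HS] := symsum_powRN rho1.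
exists (A + B * S); first by rewrite addr_gt0// mulr_gt0.
move=> m L x t m0 mL.
have mR1 : 1 <= m%:R :> R by rewrite ler1n.
set w := omega r kappa m%:R.
have w0 : 0 < w by exact: omega_gt0.
have F0 := fejer_weight_ge0 m (x - t).
rewrite !mulrDl rmorphD/=; apply: le_trans (ler_normB _ _) _; apply: lerD.
  by apply: HA => //; clear -mL m0; nia.
apply: (@le_trans _ _ (symsum L (fun l : int => B * w * fejer_weight m (x - t) *
    (if l == 0 then 0 else `|l|%:~R `^ (- ((1 + r) / 2)))))%:C).
  apply: ler_norm_symsum => l _; case: eqP => [_|/eqP l0].
    by rewrite normr0 mulr0.
  by rewrite normrM normc_expi mul1r mulrAC; exact: HB.
rewrite lecR symsum_mull [leRHS](_ : _ = B * w * fejer_weight m (x - t) * S).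
  by rewrite ler_wpM2l// mulr_ge0// mulr_ge0 ?(ltW B0) ?(ltW w0).
by ring.
Qed.

End ErrorKernelBound.

(** * Convergence of trigonometric series *)

Section TrigSeries.
Context {R : realType}.
Local Open Scope complex_scope.

Lemma normc_real (a : R) : `|a%:C| = `|a|%:C.
Proof. by rewrite normc_def /= expr0n addr0 sqrtr_sqr. Qed.

(** A positive element of the complex numbers is real, so this is the real statement. *)
Lemma cvg_realC (u : nat -> R) (l : R) : u @ \oo --> l ->
  ((fun n => (u n)%:C) : nat -> R[i]^o) @ \oo --> (l%:C : R[i]^o).
Proof.
move=> /cvgrPdist_lt ul; apply/cvgrPdist_lt => e e0.
have [e1 e2] : 0 < complex.Re e /\ e = (complex.Re e)%:C.
  by move: e0; rewrite ltcE/= => /andP[]; case: e => a b /= /eqP -> ->.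
have := ul _ e1; apply: filterS => n h.
by rewrite e2 -rmorphB normc_real ltcR.
Qed.

Lemma trig_series_lim (a : int -> R) (x l : R) :
  (fun n => complex.Re (trigsum n a x)) @ \oo --> l ->
  (forall n, complex.Im (trigsum n a x) = 0) ->
  trig_series a x = l%:C.
Proof.
move=> al a0.
have E : (fun n => trigsum n a x) = (fun n => (complex.Re (trigsum n a x))%:C).
  by apply/funext => n; move: (a0 n); case: (trigsum n a x) => p q /= ->.
have h : ((fun n => trigsum n a x) : nat -> R[i]^o) @ \oo --> (l%:C : R[i]^o).
  by rewrite E; exact: cvg_realC.
exact: (@cvg_lim R[i]^o (@norm_hausdorff _ R[i]^o) _ _ _ _ _ h).
Qed.

Lemma trigsum_even (a : int -> R) n x : (forall k, a (- k) = a k) ->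
  trigsum n a x = (a 0 + \sum_(0 <= i < n) 2 * a i.+1 * cos (i.+1%:R * x))%:C.
Proof.
move=> ev; elim: n => [|n IH].
  by rewrite /trigsum symsum0 mulr0z mul0r expi0 mulr1 big_geq// addr0.
rewrite /trigsum symsumS -/(trigsum n a x) IH ev -mulrDr mulrNz mulNr expiN_add.
by rewrite -rmorphM/= -rmorphD/= big_nat_recr//= addrA; congr (_ + _)%:C; ring.
Qed.

Lemma series_remainder (u v : nat -> R) : (forall n, `|u n| <= v n) ->
  cvgn (series v) ->
  cvgn (series u) /\ forall n, `|limn (series u) - series u n| <= limn (series v) - series v n.
Proof.
move=> uv cv.
have cu : cvgn (series u).
  apply: normed_cvg; apply: series_le_cvg cv => n; [exact: normr_ge0| |exact: uv].
  exact: le_trans (normr_ge0 _) (uv n).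
split=> // n.
have c1 : (fun p => `|series u p - series u n|) @ \oo --> `|limn (series u) - series u n|.
  by apply: cvg_norm; apply: cvgB cu _; exact: cvg_cst.
have c2 : (fun p => series v p - series v n) @ \oo --> limn (series v) - series v n.
  by apply: cvgB cv _; exact: cvg_cst.
apply: ler_cvg_to c1 c2 _.
near=> p.
have np : (n <= p)%N by near: p; exact: nbhs_infty_ge.
rewrite !sub_series_geq//; apply: le_trans (ler_norm_sum _ _ _) _.
by apply: ler_sum.
Unshelve. all: by end_near. Qed.

(** The sine terms cancel, so the series is real valued, and the remainder is bounded
    independently of [x]. Uniformity allows to pass to the limit in the finite sum over the
    nodes at once. *)
Lemma trig_series_even_uniform (a : int -> R) (v : nat -> R) :
  (forall k, a (- k) = a k) -> (forall n, `|2 * a n.+1| <= v n) -> cvgn (series v) ->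
  exists Phi : R -> R, exists rem : nat -> R,
  [/\ rem @ \oo --> 0, forall x, trig_series a x = (Phi x)%:C
    & forall n x, `|(Phi x)%:C - trigsum n a x| <= (rem n)%:C].
Proof.
move=> ev av cv.
pose u (x : R) (i : nat) := 2 * a i.+1 * cos (i.+1%:R * x).
have uv x n : `|u x n| <= v n.
  rewrite /u normrM; apply: le_trans (av n); rewrite ler_piMr//.
  by rewrite ler_norml cos_geN1 cos_le1.
exists (fun x => a 0 + limn (series (u x))), (fun n => limn (series v) - series v n).
split.
- rewrite -[X in _ --> X](subrr (limn (series v))).
  by apply: cvgB; [exact: cvg_cst|exact: cv].
- move=> x; have [cu _] := series_remainder (uv x) cv.
  have E n : trigsum n a x = (a 0 + series (u x) n)%:C by rewrite trigsum_even.
  apply: trig_series_lim => [|n]; last by rewrite E.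
  rewrite (_ : (fun n => _) = (fun n => a 0 + series (u x) n)); last first.
    by apply/funext => n; rewrite E.
  by apply: cvgD; [exact: cvg_cst|exact: cu].
- move=> n x; have [_ h] := series_remainder (uv x) cv.
  rewrite trigsum_even// -rmorphB normc_real lecR.
  by rewrite opprD addrACA subrr add0r; exact: h.
Qed.

Lemma trig_series_finite (a : int -> R) (m : nat) (x : R) :
  (forall k : int, m%:Z < `|k| -> a k = 0) -> trig_series a x = trigsum m a x.
Proof.
move=> a0.
have E n : (m <= n)%N -> trigsum n a x = trigsum m a x.
  elim: n => [|n IH]; first by rewrite leqn0 => /eqP ->.
  rewrite leq_eqVlt => /predU1P[-> //|mn].
  rewrite /trigsum symsumS -/(trigsum n a x) IH// !a0; [|lia|lia].
  by rewrite !mul0r !addr0.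
apply: (@lim_near_cst R[i]^o (@norm_hausdorff _ R[i]^o)).
by near=> n; apply: E; near: n; exact: nbhs_infty_ge.
Unshelve. all: by end_near. Qed.

End TrigSeries.

(** * Aliasing under equidistant sampling *)

Section Sampling.
Context {R : realType}.
Local Open Scope complex_scope.

Lemma expi_mulrn n (x : R) : expi (n%:R * x) = expi x ^+ n.
Proof.
elim: n => [|n IH]; first by rewrite mul0r expi0.
by rewrite -nat1r mulrDl mul1r expiD IH exprS.
Qed.

Lemma expi_2pi : expi (pi *+ 2) = 1 :> R[i].
Proof. by rewrite /expi cos2pi sin2pi. Qed.

Lemma expi_int_2pi (l : int) : expi (l%:~R * (pi *+ 2)) = 1 :> R[i].
Proof.
case: (intP l) => [|n|n]; first by rewrite mulr0z mul0r expi0.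
  by rewrite -[_%:~R]/(n.+1%:R) expi_mulrn expi_2pi expr1n.
have h : expi (n.+1%:R * (pi *+ 2) : R) = 1 by rewrite expi_mulrn expi_2pi expr1n.
by rewrite mulrNz mulNr -[LHS]mulr1 -[X in _ * X]h -expiD addNr expi0.
Qed.

(** [cos x = 1 - 2 sin (x / 2) ^ 2], and the sine is positive strictly between 0 and [pi]. *)
Lemma expi_neq1 (x : R) : 0 < `|x| -> `|x| < pi *+ 2 -> expi x != 1.
Proof.
move=> x0 x2; apply/eqP => e1.
have c1 : cos `|x| = 1.
  have : cos x = 1 by move: e1; rewrite /expi => -[].
  by case: (ger0P x) => // _; rewrite cosN.
have s0 : 0 < sin (`|x| / 2).
  apply: sin_gt0_pi; rewrite divr_gt0//= ltr_pdivrMr//.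
  by rewrite mulr_natr.
have : cos (`|x| / 2 + `|x| / 2) = 1 by rewrite -splitr.
rewrite cosD; have := cos2Dsin2 (`|x| / 2); rewrite !expr2.
by have := mulr_gt0 s0 s0; lra.
Qed.

(** A geometric sum whose ratio is a nontrivial root of unity. *)
Lemma sum_expi_node (d : int) (m : nat) : `|d| <= m.*2%:Z ->
  \sum_(0 <= k < m.*2.+1) expi (d%:~R * node R m k) =
  if d == 0 then m.*2.+1%:R else 0.
Proof.
move=> dm; have N0 : 0 < m.*2.+1%:R :> R by rewrite ltr0n.
case: eqP => [->|/eqP d0].
  under eq_bigr do rewrite mulr0z mul0r expi0.
  by rewrite sumr_const_nat subn0.
pose z : R[i] := expi (d%:~R * (pi *+ 2) / m.*2.+1%:R).
have zN : z ^+ m.*2.+1 = 1.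
  by rewrite -expi_mulrn mulrC divfK ?gt_eqF// expi_int_2pi.
have z1 : z != 1.
  have p2 : 0 < pi *+ 2 :> R by exact: two_pi_gt0.
  have nE : `|d%:~R * (pi *+ 2) / m.*2.+1%:R| = `|d|%:~R * (pi *+ 2) / m.*2.+1%:R :> R.
    by rewrite normrM normfV (gtr0_norm N0) normrM (gtr0_norm p2) intr_norm.
  apply: expi_neq1; rewrite nE.
    by rewrite divr_gt0// mulr_gt0// ltr0z normr_gt0.
  rewrite ltr_pdivrMr// mulrC ltr_pM2l// -[_%:R]/(m.*2.+1%:Z%:~R) ltr_int.
  by clear -dm; lia.
have -> : \sum_(0 <= k < m.*2.+1) expi (d%:~R * node R m k) = \sum_(i < m.*2.+1) z ^+ i.
  rewrite big_mkord; apply: eq_bigr => i _.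
  by rewrite /z -expi_mulrn; congr expi; rewrite /node; ring.
have := subrX1 z m.*2.+1; rewrite zN subrr => /esym/eqP.
by rewrite mulf_eq0 subr_eq0 (negbTE z1) => /eqP.
Qed.

Lemma symsum_delta (V : zmodType) m (j : int) (F : int -> V) : `|j| <= m%:Z ->
  symsum m (fun k => if k == j then F k else 0) = F j.
Proof.
suff : symsum m (fun k => if k == j then F k else 0) = if `|j| <= m%:Z then F j else 0.
  by move=> + h; rewrite h.
elim: m => [|m IH].
  rewrite symsum0; case: eqP => [<-|j0]; first by rewrite normr0 lexx.
  by case: ifP => //; lia.
rewrite symsumS {}IH.
have [<-|n1] := eqVneq m.+1%:Z j.
  have -> : (`|m.+1%:Z| <= m%:Z) = false by clear; lia.
  have -> : (`|m.+1%:Z| <= m.+1%:Z) = true by clear; lia.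
  have -> : (- m.+1%:Z == m.+1%:Z) = false by clear; lia.
  by rewrite add0r addr0.
have [<-|n2] := eqVneq (- m.+1%:Z) j.
  have -> : (`|- m.+1%:Z| <= m%:Z) = false by clear; lia.
  have -> : (`|- m.+1%:Z| <= m.+1%:Z) = true by clear; lia.
  by rewrite !add0r.
rewrite !addr0; congr (if _ then _ else _).
by clear -n1 n2; lia.
Qed.

Lemma symsum_mulr (F : int -> R[i]) m c : symsum m F * c = symsum m (fun k => F k * c).
Proof. exact: mulr_suml. Qed.

Lemma mulr_symsum (F : int -> R[i]) m c : c * symsum m F = symsum m (fun k => c * F k).
Proof. exact: mulr_sumr. Qed.

Lemma sum_symsum (F : nat -> int -> R[i]) m n :
  \sum_(0 <= k < n) symsum m (F k) = symsum m (fun j => \sum_(0 <= k < n) F k j).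
Proof. exact: exchange_big. Qed.

(** Only pairs of frequencies congruent modulo [N] survive the average over the nodes, and
    [|j|, |j'| <= m] leaves the single frequency [j] of the cutoff kernel. *)
Lemma sampling_sum (a b : int -> R) m L x t :
  \sum_(0 <= k < m.*2.+1) trigsum m b (node R m k - t) *
     trigsum (L * m.*2.+1 + m) a (x - node R m k) =
  m.*2.+1%:R * symsum L (fun l => symsum m (fun j =>
    (a (j + l * m.*2.+1%:Z) * b j)%:C *
    (expi ((j + l * m.*2.+1%:Z)%:~R * x) * expi (- (j%:~R * t))))).
Proof.
have N0 : 0 < m.*2.+1%:R :> R by rewrite ltr0n.
pose G l j j' : R[i] := (a (j + l * m.*2.+1%:Z) * b j')%:C *
    (expi ((j + l * m.*2.+1%:Z)%:~R * x) * expi (- (j'%:~R * t))).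
under eq_bigr => k _.
  rewrite /trigsum symsum_blocks mulr_symsum.
  under eq_symsum => l _.
    rewrite mulr_symsum; under eq_symsum => j _.
      rewrite symsum_mulr; under eq_symsum => j' _.
        have -> : (b j')%:C * expi (j'%:~R * (node R m k - t)) *
           ((a (j + l * m.*2.+1%:Z))%:C *
            expi ((j + l * m.*2.+1%:Z)%:~R * (x - node R m k))) =
           G l j j' * expi ((j' - j)%:~R * node R m k).
          have -> : j'%:~R * (node R m k - t) = - (j'%:~R * t) + j'%:~R * node R m k by ring.
          have -> : (j + l * m.*2.+1%:Z)%:~R * (x - node R m k) =
              (j + l * m.*2.+1%:Z)%:~R * x + (- j)%:~R * node R m k
              + (- (l * k%:Z))%:~R * (pi *+ 2).
            by rewrite /node !(intrD, mulrNz, intrM); field; rewrite gt_eqF.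
          rewrite intrB mulrBl mulrNz mulNr !expiD expi_int_2pi mulr1 /G rmorphM/=.
          by ring.
        over.
      over.
    over.
  over.
rewrite sum_symsum mulr_symsum; apply: eq_symsum => l _.
rewrite sum_symsum mulr_symsum; apply: eq_symsum => j jm.
rewrite sum_symsum.
rewrite -[RHS](@symsum_delta _ m j (fun j' => m.*2.+1%:R * G l j j') jm).
apply: eq_symsum => j' j'm; rewrite -mulr_sumr sum_expi_node; last by clear -jm j'm; lia.
rewrite subr_eq0; case: eqP => _; first by rewrite mulrC.
by rewrite mulr0.
Qed.

Lemma symsum_widen (V : zmodType) m n (F : int -> V) : (m <= n)%N ->
  (forall k : int, m%:Z < `|k| -> F k = 0) -> symsum n F = symsum m F.
Proof.
move=> mn F0; elim: n mn => [|n IH]; first by rewrite leqn0 => /eqP ->.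
rewrite leq_eqVlt => /predU1P[-> //|mn].
by rewrite symsumS IH// !F0 ?addr0//; clear -mn; lia.
Qed.

Lemma symsum_split0 (V : zmodType) n (F : int -> V) :
  symsum n F = F 0 + symsum n (fun l => if l == 0 then 0 else F l).
Proof.
elim: n => [|n IH]; first by rewrite !symsum0 eqxx addr0.
by rewrite !symsumS IH/= -addrA.
Qed.

(** The copy [l = 0] of the sampled kernel is [phi * H_m] and combines with the first term
    into the coefficients [lam (1 - theta)]. The other copies are the aliases. *)
Lemma partial_kernelE (theta lam : R -> R) m L x t : (0 < m)%N ->
  (forall x, ~ (- 1 < x < 1) -> theta x = 0) ->
  partial_kernel theta lam m L x t =
  trigsum (L * m.*2.+1 + m) (fun k => lam k%:~R) (x - t) -
  m.*2.+1%:R^-1 * \sum_(0 <= k < m.*2.+1)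
    trigsum m (fun k => theta (k%:~R / m%:R)) (node R m k - t) *
    trigsum (L * m.*2.+1 + m) (fun k => lam k%:~R) (x - node R m k).
Proof.
move=> m0 th0.
have mR0 : 0 < m%:R :> R by rewrite ltr0n.
have z (k : int) : m%:Z < `|k| -> theta (k%:~R / m%:R) = 0.
  move=> mk; apply: th0 => /andP[k1 k2].
  have : `|k%:~R / m%:R : R| < 1 by rewrite ltr_norml k1.
  rewrite normrM normfV (gtr0_norm mR0) ltr_pdivrMr// mul1r -intr_norm.
  by rewrite -[m%:R]/(m%:Z%:~R) ltr_int ltNge ltW.
rewrite sampling_sum mulrA mulVf ?mul1r ?pnatr_eq0//.
rewrite /partial_kernel [in RHS]symsum_split0 opprD addrA; congr (_ - _); last first.
  apply: eq_symsum => l _; case: eqP => // _.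
  rewrite /trigsum mulr_symsum; apply: eq_symsum => j _.
  have -> : (j + l * m.*2.+1%:Z)%:~R * x =
    (l * m.*2.+1%:Z)%:~R * x + j%:~R * x by rewrite intrD mulrDl addrC.
  by rewrite mulrBr !expiD /alias_coef; ring.
rewrite -(@symsum_widen _ m (L * m.*2.+1 + m)); first last.
- by move=> k mk; rewrite z// mulr0 mul0r.
- exact: leq_addl.
rewrite /trigsum -symsumB; apply: eq_symsum => k _.
rewrite mul0r addr0 -expiD -mulrBr /high_coef -mulrBl -rmorphB/=.
by congr (_%:C * _); ring.
Qed.

End Sampling.

(** * The error kernel *)

Section ErrorKernel.
Context {R : realType}.
Local Open Scope complex_scope.

(** The Potter bound with [t = 1] gives absolute summability of the mask. *)
Lemma phi_uniform (lam : R -> R) (r kappa : R) : 1 < r ->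
  (exists M : R, forall x, `|lam x| <= M) -> is_mask r kappa lam ->
  exists Phi : R -> R, exists rem : nat -> R,
  [/\ rem @ \oo --> 0, forall x, phi lam x = (Phi x)%:C
    & forall n x, `|(Phi x)%:C - trigsum n (fun k => lam k%:~R) x| <= (rem n)%:C].
Proof.
move=> hr hlamb hlam.
have [C C0 HC] := mask_differences_le hr hlamb hlam.
have [P P0 HP] := omega_potter kappa hr.
have rho1 : 1 < (1 + r) / 2 by lra.
have [S S0 HS] := tail_weight_sum rho1.
have w1 : 0 < omega r kappa 1 by exact: omega_gt0.
pose K := 2 * (C * (P * omega r kappa 1)).
have K0 : 0 <= K by rewrite /K; apply: mulr_ge0; [exact: ler0n|apply: mulr_ge0; [exact: ltW|apply: mulr_ge0; exact: ltW]].
apply: (@trig_series_even_uniform _ (fun k => lam k%:~R)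
  (fun i => K * tail_weight ((1 + r) / 2) 1 i.+1%:R)).
- by move=> k; rewrite mulrNz; case: hlam.
- move=> n; rewrite normrM ger0_norm//.
  set T := tail_weight _ _ _.
  have -> : K * T = 2 * (C * (P * (omega r kappa 1 * T))) by rewrite /K; ring.
  rewrite ler_wpM2l//.
  have [h _ _ _] := HC n.+1%:R; apply: le_trans h _; rewrite ler_wpM2l ?(ltW C0)//.
  rewrite normr_nat.
  have s1 : 1 <= 1 + n.+1%:R :> R by rewrite lerDl.
  have l11 : 1 <= 1 :> R by [].
  have s4 : 1 <= 4 * (1 + n.+1%:R) :> R by rewrite (le_trans s1)// ler_peMl ?(le_trans ler01)// ler1n.
  apply: le_trans (HP _ _ s1 l11 s4) _; rewrite -mulrA ler_wpM2l ?(ltW P0)//.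
  rewrite ler_wpM2l ?(ltW w1)// /T /tail_weight -natrM ler1n/=.
  rewrite !divr1; apply: ler_powRN => //; first by rewrite (le_trans ler01)// ltW.
  by rewrite lerDr.
- apply: nondecreasing_is_cvgn.
    apply/nondecreasing_seqP => n; rewrite /series/= big_nat_recr//= lerDl.
    by rewrite mulr_ge0// tail_weight_ge0.
  exists (K * (S * 1%:R)) => _ [n _ <-].
  rewrite /series/= -mulr_sumr ler_wpM2l// big_mkord; exact: HS.
Qed.

(** [f - Q f] is the integral of this kernel against [g]. *)
Definition error_kernel (theta lam : R -> R) (m : nat) (x t : R) : R[i] :=
  phi lam (x - t) - m.*2.+1%:R^-1 *
    \sum_(0 <= k < m.*2.+1) kernelH theta m (node R m k - t) * phi lam (x - node R m k).

Lemma kernelHE (theta : R -> R) m x : cutoff theta -> (0 < m)%N ->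
  kernelH theta m x = trigsum m (fun k => theta (k%:~R / m%:R)) x.
Proof.
move=> [_ _ th0] m0; have mR0 : 0 < m%:R :> R by rewrite ltr0n.
apply: trig_series_finite => k mk; apply: th0 => /andP[k1 k2].
have : `|k%:~R / m%:R : R| < 1 by rewrite ltr_norml k1.
rewrite normrM normfV (gtr0_norm mR0) ltr_pdivrMr// mul1r -intr_norm.
by rewrite -[m%:R]/(m%:Z%:~R) ltr_int ltNge ltW.
Qed.

Lemma error_kernel_le (theta lam : R -> R) (r kappa : R) :
  cutoff theta -> 1 < r -> (exists M : R, forall x, `|lam x| <= M) ->
  is_mask r kappa lam ->
  exists2 A : R, 0 < A & forall (m : nat) (x t : R), (0 < m)%N ->
    `|error_kernel theta lam m x t| <=
      (A * omega r kappa m%:R * fejer_weight m (x - t))%:C.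
Proof.
move=> htheta hr hlamb hlam.
have [A A0 HA] := partial_kernel_le htheta hr hlamb hlam.
have [Phi [rem [rem0 phiE phi_rem]]] := phi_uniform hr hlamb hlam.
exists A => // m x t m0.
set B := A * _ * _.
pose H := symsum m (fun k => `|theta (k%:~R / m%:R)|).
have H0 : 0 <= H by apply: sumr_ge0.
(* The kernel differs from its truncation by the remainder of phi, once from the term
   phi (x - t) and once, weighted by H, from the average over the nodes. *)
have bound L : (m <= L)%N ->
    Normc.normc (error_kernel theta lam m x t) <= B + rem (L * m.*2.+1 + m)%N * (1 + H).
  move=> mL; rewrite -lecR.
  rewrite -[X in X <= _]/(`|error_kernel theta lam m x t|).
  have -> : error_kernel theta lam m x t = partial_kernel theta lam m L x t +
     (error_kernel theta lam m x t - partial_kernel theta lam m L x t) by ring.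
  apply: le_trans (ler_normD _ _) _; rewrite rmorphD/=; apply: lerD; first exact: HA.
  set n := (L * _ + m)%N.
  have [_ _ th0] := htheta.
  rewrite partial_kernelE// -/n /error_kernel.
  have -> : \sum_(0 <= k < m.*2.+1) kernelH theta m (node R m k - t) * phi lam (x - node R m k)
    = \sum_(0 <= k < m.*2.+1) trigsum m (fun k => theta (k%:~R / m%:R)) (node R m k - t) *
        (Phi (x - node R m k))%:C.
    by apply: eq_bigr => k _; rewrite kernelHE// phiE.
  have remC k : 0 <= (rem k)%:C by apply: le_trans (phi_rem k x).
  pose T y := trigsum n (fun k => lam k%:~R) y.
  pose h k := trigsum m (fun k => theta (k%:~R / m%:R)) (node R m k - t).
  rewrite phiE; set X := (X in `|X| <= _).
  have -> : X = ((Phi (x - t))%:C - T (x - t)) - m.*2.+1%:R^-1 *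
      \sum_(0 <= k < m.*2.+1) h k * ((Phi (x - node R m k))%:C - T (x - node R m k)).
    under [in RHS]eq_bigr do rewrite mulrBr.
    by rewrite sumrB /X /h /T mulrBr; ring.
  rewrite mulrDr mulr1 rmorphD/=; apply: le_trans (ler_normB _ _) _; apply: lerD.
    exact: phi_rem.
  rewrite normrM normfV normr_nat ler_pdivrMl ?ltr0n//.
  apply: le_trans (ler_norm_sum _ _ _) _.
  apply: (@le_trans _ _ (\sum_(0 <= k < m.*2.+1) (rem n * H)%:C)).
    apply: ler_sum => k _; rewrite normrM mulrC rmorphM/=; apply: ler_pM => //.
      exact: phi_rem.
    exact: normc_trigsum.
  by rewrite sumr_const_nat subn0 mulr_natl.
have nn : `|error_kernel theta lam m x t| = (Normc.normc (error_kernel theta lam m x t))%:C by [].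
rewrite nn lecR; apply/ler_addgt0Pr => e e0.
have eH : 0 < e / (1 + H) by rewrite divr_gt0// ltr_wpDr.
move/cvgrPdist_lt : rem0 => /(_ _ eH) [p0 _ hp].
have := bound (maxn m p0) (leq_maxl _ _).
set n := (_ * _ + m)%N => /le_trans; apply; rewrite lerD2l.
rewrite -ler_pdivlMr ?ltr_wpDr//.
have np : (p0 <= n)%N by rewrite /n; have := leq_maxr m p0; clear; nia.
have := hp n np; rewrite /= sub0r normrN => /ltW; apply: le_trans.
exact: ler_norm.
Qed.

End ErrorKernel.

(** * The Fejer weight has bounded integral *)

Section FejerIntegral.
Context {R : realType}.

(** From [sin v >= v cos v] with [v = u / 2]: then [sin u = 2 sin v cos v >= 2 v cos v ^ 2],
    and [2 cos v ^ 2 = 1 + cos u >= 1]. *)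
Lemma sin_ge_half (u : R) : 0 <= u -> u <= pi / 2 -> u / 2 <= sin u.
Proof.
move=> u0 u2.
have ch : 0 <= cos u.
  by apply: cos_ge0_pihalf; rewrite u2 andbT; have := pi_ge0 R; lra.
set v := u / 2.
have uE : u = v + v by rewrite /v -splitr.
have v0 : 0 <= v by rewrite divr_ge0.
have sv : v * cos v <= sin v.
  have [<-|vn] := eqVneq 0 v; first by rewrite mul0r sin0.
  have vp : 0 < v by rewrite lt_neqAle vn.
  have [|c] := @MVT R sin cos 0 v vp.
    by apply: derivable_within_continuous => x _; exact: derivable_sin.
  rewrite in_itv/= => /andP[c0 cv]; rewrite sin0 !subr0 => ->.
  rewrite mulrC ler_wpM2r//.
  have pi0 := pi_ge0 R.
  have vpi : v <= pi by rewrite /v; lra.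
  rewrite le_eqVlt; apply/orP; right.
  by rewrite ltr_cos// in_itv/=; apply/andP; split; lra.
have cv : 0 <= cos v.
  apply: cos_ge0_pihalf; have := pi_ge0 R; rewrite /v; lra.
have := cos2Dsin2 v; rewrite uE cosD in ch.
rewrite [in leRHS]uE sinD !expr2 => cs.
have : v * (cos v * cos v) <= sin v * cos v by rewrite mulrA ler_wpM2r.
have : v * (cos v * cos v) >= v * 2^-1 by apply: ler_wpM2l => //; lra.
lra.
Qed.

(** [2 - 2 cos z = 4 sin (z / 2) ^ 2]. *)
Lemma cos_quadratic_le (z : R) : `|z| <= pi -> z ^+ 2 / 4 <= 2 - 2 * cos z.
Proof.
move=> zpi; have -> : cos z = cos `|z| by case: (ger0P z) => // _; rewrite cosN.
rewrite -[z ^+ 2]real_normK ?num_real//.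
set y := `|z| in zpi *; have y0 : 0 <= y by exact: normr_ge0.
have [h0 h2] : 0 <= y / 2 /\ y / 2 <= pi / 2 by split; lra.
have := sin_ge_half h0 h2.
rewrite [in cos y](_ : y = y / 2 + y / 2); last by rewrite -splitr.
rewrite cosD; have := cos2Dsin2 (y / 2); rewrite !expr2.
set s := sin _; set c := cos _ => cs sy.
have : (y / 2 / 2) * (y / 2 / 2) <= s * s by apply: ler_pM => //; lra.
lra.
Qed.

(** A weight with an elementary primitive, an arctangent. *)
Definition cauchy_weight (m : nat) (z : R) : R := m%:R / (1 + (m%:R * z) ^+ 2).

Lemma cauchy_weight_ge0 m z : 0 <= cauchy_weight m z.
Proof. by rewrite divr_ge0// addr_ge0// sqr_ge0. Qed.

Lemma fejer_weight_le_cauchy m z : `|z| <= pi -> fejer_weight m z <= 4 * cauchy_weight m z.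
Proof.
move=> zpi; have d1 := fejer_denom_ge1 m z.
have d2 : 1 <= 1 + (m%:R * z) ^+ 2 by rewrite lerDl sqr_ge0.
rewrite /fejer_weight /cauchy_weight mulrA ler_pdivrMr; last by lra.
rewrite mulrAC ler_pdivlMr; last by lra.
rewrite [leRHS](_ : _ = m%:R * (4 * (1 + m%:R ^+ 2 * (2 - 2 * cos z)))); last by ring.
rewrite ler_wpM2l//.
have := cos_quadratic_le zpi; rewrite exprMn.
have : 0 <= m%:R ^+ 2 :> R by rewrite exprn_ge0.
set M := _ ^+ 2; set Z := _ ^+ 2 => M0 h.
have : M * (Z / 4) <= M * (2 - 2 * cos z) by rewrite ler_wpM2l.
lra.
Qed.

Lemma cos_int_2pi (x : R) (l : int) : cos (x + l%:~R * (pi *+ 2)) = cos x.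
Proof.
have := @expi_int_2pi R l; rewrite /expi => -[c s].
by rewrite cosD c s mulr1 mulr0 subr0.
Qed.

Lemma fejer_weight_periodic m (x : R) (l : int) :
  fejer_weight m (x + l%:~R * (pi *+ 2)) = fejer_weight m x.
Proof. by rewrite /fejer_weight cos_int_2pi. Qed.

Lemma fejer_weightN m (x : R) : fejer_weight m (- x) = fejer_weight m x.
Proof. by rewrite /fejer_weight cosN. Qed.

(** For [|y| <= 2 pi] one of [y], [y - 2 pi], [y + 2 pi] lies in [[- pi, pi]]. *)
Lemma fejer_weight_le m (y : R) : `|y| <= pi *+ 2 ->
  fejer_weight m y <= 4 * (cauchy_weight m y + cauchy_weight m (y - pi *+ 2)
    + cauchy_weight m (y + pi *+ 2)).
Proof.
move=> y2; have c0 := cauchy_weight_ge0 m.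
have [y1|y1] := leP `|y| pi.
  apply: le_trans (fejer_weight_le_cauchy m y1) _.
  by rewrite ler_wpM2l// -addrA lerDl addr_ge0.
have [y0|y0] := leP 0 y.
  rewrite -(fejer_weight_periodic m y (-1)) mulN1r.
  apply: le_trans (@fejer_weight_le_cauchy m _ _) _.
    move: y1 y2; rewrite ger0_norm// => y1 y2; rewrite ler0_norm; lra.
  by rewrite ler_wpM2l// addrAC lerDr addr_ge0.
rewrite -(fejer_weight_periodic m y 1) mul1r.
apply: le_trans (@fejer_weight_le_cauchy m _ _) _.
  move: y1 y2; rewrite ltr0_norm// => y1 y2; rewrite ger0_norm; lra.
by rewrite ler_wpM2l// lerDr addr_ge0.
Qed.

Lemma cauchy_weight_continuous m (a : R) : continuous (fun x => cauchy_weight m (x - a)).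
Proof.
move=> x; apply: cvgM; first exact: cvg_cst.
apply: cvgV; first by rewrite gt_eqF// ltr_wpDr// sqr_ge0.
apply: cvgD; first exact: cvg_cst.
rewrite expr2; under [X in X @ _]eq_fun do rewrite expr2.
have h : (fun y => m%:R * (y - a)) @ x --> m%:R * (x - a).
  by apply: cvgM; [exact: cvg_cst|apply: cvgB; [exact: cvg_id|exact: cvg_cst]].
exact: cvgM.
Qed.

Lemma fejer_weight_continuous m : continuous (fejer_weight m : R -> R).
Proof.
move=> x; apply: cvgM; first exact: cvg_cst.
apply: cvgV; first by rewrite gt_eqF// (lt_le_trans _ (fejer_denom_ge1 m x)).
apply: cvgD; first exact: cvg_cst.
apply: cvgM; first exact: cvg_cst.
apply: cvgB; first exact: cvg_cst.
by apply: cvgM; [exact: cvg_cst|exact: continuous_cos].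
Qed.

Lemma integral_cauchy_weight (m : nat) (a b c : R) : b < c ->
  (\int[lebesgue_measure]_(x in `[b, c]) (cauchy_weight m (x - a))%:E <= pi%:E)%E.
Proof.
move=> bc.
pose F x : R := atan (m%:R * (x - a)).
have dF (x : R) : is_derive x 1 F (cauchy_weight m (x - a)).
  have d1 : is_derive x 1 (fun y : R => m%:R * (y - a)) m%:R.
    have := is_deriveZ (m%:R : R) (is_deriveB (is_derive_id x (1 : R)) (is_derive_cst a x (1 : R))).
    by rewrite subr0 /GRing.scale/= mulr1.
  have := @is_derive1_comp R atan _ x _ _ (is_derive1_atan (m%:R * (x - a))) d1.
  by rewrite /cauchy_weight mulrC.
have cF : continuous F.
  by move=> x; apply/differentiable_continuous/derivable1_diffP; case: (dF x).
rewrite (@continuous_FTC2 R _ F)//.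
- rewrite -EFinB lee_fin /F.
  have := atan_ltpi2 (m%:R * (c - a)); have := atan_gtNpi2 (m%:R * (b - a)).
  by clear; lra.
- by apply: continuous_subspaceT; exact: cauchy_weight_continuous.
- split.
  + by move=> x _; case: (dF x).
  + apply: cvg_at_right_filter; exact: cF.
  + apply: cvg_at_left_filter; exact: cF.
- by move=> x _; rewrite derive1E; exact: derive_val.
Qed.

End FejerIntegral.

(** * Schur test in Lp *)

Section Schur.
Context {R : realType}.

(** Optimization over [s]: the two terms balance at [s = (j / B) ^ (1 / p)]. *)
Lemma schur_pointwise (p B h j : R) : 1 <= p -> 0 < B -> 0 <= h -> 0 <= j ->
  (forall s, 0 < s -> h <= s * B + s `^ (1 - p) * j) ->
  h `^ p <= (2 * B) `^ p / B * j.
Proof.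
move=> p1 B0 h0 j0 H.
have pn0 : p != 0 by rewrite gt_eqF// (lt_le_trans _ p1).
have [jz|jn] := eqVneq j 0.
  have hz : h = 0.
    apply/eqP; rewrite eq_le h0 andbT; apply/ler_addgt0Pr => e e0.
    have := H (e / B) (divr_gt0 e0 B0).
    by rewrite jz mulr0 addr0 divfK ?gt_eqF// add0r.
  by rewrite hz jz powR0// mulr0.
have jp : 0 < j by rewrite lt_neqAle eq_sym jn.
have jB : 0 < j / B by rewrite divr_gt0.
pose s := (j / B) `^ p^-1.
have s0 : 0 < s by rewrite powR_gt0.
have sp : s `^ p = j / B by rewrite /s -powRrM mulVf// powRr1// ltW.
have E : s `^ (1 - p) * j = s * B.
  rewrite powRD; last by rewrite (gt_eqF s0) implybT.
  rewrite powRr1 ?(ltW s0)// powRN sp.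
  by field; rewrite !gt_eqF.
have := H s s0; rewrite E => hs.
have -> : (2 * B) `^ p / B * j = (2 * B * s) `^ p.
  rewrite (@powRM _ (2 * B)) ?(ltW s0)// ?mulr_ge0 ?(ltW B0)// sp; by ring.
have BBs : 0 <= 2 * B * s by apply: mulr_ge0 (ltW s0); apply: mulr_ge0 (ltW B0).
have p0 : 0 <= p by exact: le_trans p1.
apply: ge0_ler_powR; rewrite ?nnegrE//.
by apply: le_trans hs _; rewrite le_eqVlt; apply/orP; left; apply/eqP; ring.
Qed.

(** Stands in for the inequality of Hoelder with weight [w], without singling out [p = 1]:
    either [g <= s], or [g <= s (g / s) ^ p]. *)
Lemma young_split (p s g : R) : 1 <= p -> 0 < s -> 0 <= g ->
  g <= s + s `^ (1 - p) * g `^ p.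
Proof.
move=> p1 s0 g0.
have [gs|gs] := leP g s; first by rewrite (le_trans gs)// lerDl mulr_ge0 ?powR_ge0.
have gp : 0 < g by exact: lt_trans gs.
apply: (@le_trans _ _ (s `^ (1 - p) * g `^ p)); last by rewrite lerDr ltW.
apply: (@le_trans _ _ (g `^ (1 - p) * g `^ p)).
  by rewrite -powRD ?(gt_eqF gp) ?implybT// subrK powRr1.
rewrite ler_wpM2r ?powR_ge0// (_ : 1 - p = - (p - 1)); last by ring.
by apply: ler_powRN => //; [rewrite subr_ge0|exact: ltW].
Qed.

Context d (T : measurableType d) (mu : probability T R).
Variables (w : T * T -> R) (G h : T -> R) (B : R).
Hypotheses (mw : measurable_fun setT w) (w0 : forall z, 0 <= w z).
Hypotheses (mG : measurable_fun setT G) (G0 : forall t, 0 <= G t).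
Hypotheses (mh : measurable_fun setT h) (h0 : forall t, 0 <= h t).
Hypothesis B0 : 0 < B.
Hypothesis wx : forall x, (\int[mu]_t (w (x, t))%:E <= B%:E)%E.
Hypothesis wt : forall t, (\int[mu]_x (w (x, t))%:E <= B%:E)%E.
Hypothesis hG : {ae mu, forall x, ((h x)%:E <= \int[mu]_t (w (x, t) * G t)%:E)%E}.

Let mwx x : measurable_fun setT (fun t => w (x, t)).
Proof. exact: (measurableT_comp mw (pair1_measurable x)). Qed.

Let mwt t : measurable_fun setT (fun x => w (x, t)).
Proof. exact: (measurableT_comp mw (pair2_measurable t)). Qed.

(** With [J x = int w(x, t) G(t)^p dt], splitting [G] at level [s] and optimizing [s] for
    each [x] gives [h(x)^p <= (2 B)^p / B * J x]; by Tonelli the integral of [J] is at most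
    [B] times that of [G^p]. *)
Lemma schur_power (p : R) : 1 <= p ->
  (\int[mu]_x (h x `^ p)%:E <= ((2 * B) `^ p)%:E * \int[mu]_t (G t `^ p)%:E)%E.
Proof.
move=> p1.
pose K := (2 * B) `^ p / B.
have K0 : 0 < K by rewrite divr_gt0//; apply: powR_gt0; rewrite mulr_gt0.
have mGp : measurable_fun setT (fun t => G t `^ p).
  exact: (measurableT_comp (measurable_powR p) mG).
have mJ : measurable_fun setT (fun z : T * T => (w z * G z.2 `^ p)%:E).
  apply/measurable_EFinP; apply: measurable_funM => //.
  exact: (measurableT_comp mGp measurable_snd).
have J0 (z : T * T) : (0 <= (w z * G z.2 `^ p)%:E)%E.
  by rewrite lee_fin mulr_ge0 ?powR_ge0.
pose J x := (\int[mu]_t (w (x, t) * G t `^ p)%:E)%E.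
have hJ : {ae mu, forall x, setT x -> ((h x `^ p)%:E <= K%:E * J x)%E}.
  apply: filterS hG => x hx _.
  have Jx0 : (0 <= J x)%E by apply: integral_ge0 => t _; exact: (J0 (x, t)).
  have [Jy|Jfin] := eqVneq (J x) +oo%E.
    by rewrite Jy gt0_muley ?lte_fin// leey.
  have Jr : (J x \is a fin_num)%E by rewrite ge0_fin_numE// ltey.
  rewrite -(fineK Jr) -EFinM lee_fin; apply: schur_pointwise => //.
    exact: fine_ge0.
  move=> s s0; rewrite -lee_fin; apply: le_trans hx _.
  have sB0 : 0 <= s `^ (1 - p) by exact: powR_ge0.
  apply: (@le_trans _ _ (\int[mu]_t (s%:E * (w (x, t))%:E +
     (s `^ (1 - p))%:E * (w (x, t) * G t `^ p)%:E))%E).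
    apply: ge0_le_integral => //.
    - by move=> t _; rewrite lee_fin mulr_ge0.
    - by apply/measurable_EFinP; exact: measurable_funM.
    - apply: emeasurable_funD; apply: emeasurable_funM => //.
        by apply/measurable_EFinP.
      by apply/measurable_EFinP; exact: measurable_funM.
    - move=> t _; rewrite -!EFinM -EFinD lee_fin.
      have := @young_split p s (G t) p1 s0 (G0 t).
      move=> /(ler_wpM2l (w0 (x, t))) /le_trans; apply.
      by rewrite le_eqVlt; apply/orP; left; apply/eqP; ring.
  rewrite ge0_integralD//; first last.
  - apply: emeasurable_funM => //; apply/measurable_EFinP; exact: measurable_funM.
  - by move=> t _; rewrite -EFinM lee_fin mulr_ge0// mulr_ge0 ?powR_ge0.
  - by apply: emeasurable_funM => //; apply/measurable_EFinP.
  - by move=> t _; rewrite -EFinM lee_fin mulr_ge0// ltW.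
  have mW : measurable_fun setT (fun t => (w (x, t))%:E) by exact/measurable_EFinP.
  have mWG : measurable_fun setT (fun t => (w (x, t) * G t `^ p)%:E).
    by apply/measurable_EFinP; exact: measurable_funM.
  rewrite (@ge0_integralZl _ _ _ mu _ measurableT _ mW); last 2 first.
  - by move=> t _; rewrite lee_fin.
  - by rewrite lee_fin ltW.
  rewrite (@ge0_integralZl _ _ _ mu _ measurableT _ mWG); last 2 first.
  - by move=> t _; exact: (J0 (x, t)).
  - by rewrite lee_fin.
  rewrite EFinD !EFinM fineK// leeD//.
  by apply: lee_pmul => //; [rewrite lee_fin ltW|apply: integral_ge0 => t _; rewrite lee_fin].
have mhp : measurable_fun setT (fun x => (h x `^ p)%:E).
  by apply/measurable_EFinP; exact: (measurableT_comp (measurable_powR p) mh).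
have mJx : measurable_fun setT J.
  exact: (@measurable_fun_fubini_tonelli_F _ _ _ _ _ mu _ mJ J0).
have Jx0 x : (0 <= J x)%E by apply: integral_ge0 => t _; exact: (J0 (x, t)).
apply: (@le_trans _ _ (\int[mu]_x (K%:E * J x))%E).
  apply: ae_ge0_le_integral => //.
  - by move=> x _; rewrite lee_fin powR_ge0.
  - by move=> x _; rewrite mule_ge0// lee_fin ltW.
  - exact: emeasurable_funM.
rewrite (@ge0_integralZl _ _ _ mu _ measurableT _ mJx); last 2 first.
- by move=> x _; exact: Jx0.
- by rewrite lee_fin ltW.
rewrite /J (@fubini_tonelli _ _ _ _ _ mu mu _ mJ J0)/=.
have -> : ((2 * B) `^ p)%:E = (K%:E * B%:E)%E.
  by rewrite -EFinM /K divfK// gt_eqF.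
rewrite -muleA; apply: lee_pmul => //.
- by rewrite lee_fin ltW.
- by apply: integral_ge0 => t _; apply: integral_ge0 => x _; exact: (J0 (x, t)).
have mGpE : measurable_fun setT (fun t => (G t `^ p)%:E) by exact/measurable_EFinP.
rewrite -(@ge0_integralZl _ _ _ mu _ measurableT _ mGpE); last 2 first.
- by move=> t _; rewrite lee_fin powR_ge0.
- by rewrite lee_fin ltW.
apply: ge0_le_integral; first exact: measurableT.
- by move=> t _; apply: integral_ge0 => x _; exact: (J0 (x, t)).
- exact: (@measurable_fun_fubini_tonelli_G _ _ _ _ _ mu _ mJ J0).
- exact: emeasurable_funM.
move=> t _.
under eq_integral do rewrite mulrC EFinM.
have mW : measurable_fun setT (fun x => (w (x, t))%:E) by exact/measurable_EFinP.
rewrite (@ge0_integralZl _ _ _ mu _ measurableT _ mW); last 2 first.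
- by move=> x _; rewrite lee_fin.
- by rewrite lee_fin powR_ge0.
by rewrite muleC lee_pmul// ?lee_fin ?powR_ge0//; apply: integral_ge0 => x _; rewrite lee_fin.
Qed.

Lemma schur_test (p : \bar R) : (1 <= p)%E ->
  (Lnorm mu p (EFin \o h) <= (2 * B)%:E * Lnorm mu p (EFin \o G))%E.
Proof.
have B20 : 0 < 2 * B by rewrite mulr_gt0.
case: p => [p p1|_|//]; rewrite unlock /Lnorm.
  rewrite lee_fin in p1.
  have p0 : 0 < p by exact: lt_le_trans p1.
  have I0 : (0 <= \int[mu]_x (`|(EFin \o G) x| `^ p))%E.
    by apply: integral_ge0 => x _; exact: poweR_ge0.
  have -> : (2 * B)%:E = (((2 * B) `^ p)%:E `^ p^-1)%E.
    by rewrite poweR_EFin -powRrM mulfV ?gt_eqF// powRr1// ltW.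
  rewrite -poweRM//; last by rewrite lee_fin powR_ge0.
  have E f : (forall x, 0 <= f x) ->
      (\int[mu]_x (`|(EFin \o f) x| `^ p) = \int[mu]_x (f x `^ p)%:E)%E.
    by move=> f0; apply: eq_integral => x _; rewrite /= ger0_norm// f0.
  apply: gt0_ler_poweR; rewrite ?invr_ge0 ?(ltW p0)//.
  - by rewrite in_itv/= leey andbT; apply: integral_ge0 => x _; rewrite lee_fin powR_ge0.
  - by rewrite in_itv/= leey andbT mule_ge0// lee_fin powR_ge0.
  by rewrite !E//; exact: schur_power.
have mu0 : (0 < mu setT)%E by rewrite (_ : mu setT = 1%E) ?lte01//; exact: probability_setT.
rewrite !ifT//.
set M := ess_sup mu (abse \o (EFin \o G)).
have GM : {ae mu, forall t, setT t -> ((G t)%:E <= M)%E}.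
  apply: filterS (ess_sup_ge mu (abse \o (EFin \o G))) => t /=.
  by rewrite ger0_norm.
have M0 : (0 <= M)%E.
  by apply: ess_sup_gee => //; apply: aeW => t; exact: abse_ge0.
apply/ess_supP; apply: filterS hG => x hx /=; rewrite ger0_norm//.
apply: le_trans hx _.
apply: (@le_trans _ _ (\int[mu]_t (M * (w (x, t))%:E))%E).
  apply: ae_ge0_le_integral => //.
  - by move=> t _; rewrite lee_fin mulr_ge0.
  - by apply/measurable_EFinP; exact: measurable_funM.
  - by move=> t _; rewrite mule_ge0// lee_fin.
  - by apply: emeasurable_funM => //; apply/measurable_EFinP.
  - apply: filterS GM => t /(_ I) h1 _.
    by rewrite EFinM muleC; apply: lee_pmul; rewrite ?lee_fin.
have mW : measurable_fun setT (fun t => (w (x, t))%:E) by exact/measurable_EFinP.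
rewrite (@ge0_integralZl _ _ _ mu _ measurableT _ mW)//; last first.
  by move=> t _; rewrite lee_fin.
rewrite muleC; apply: lee_pmul => //; first by apply: integral_ge0 => t _; rewrite lee_fin.
by apply: le_trans (wx x) _; rewrite lee_fin ler_peMl ?(ltW B0)// ler1n.
Qed.

End Schur.

(** * The Fejer weight on the torus *)

Section TorusFejer.
Context {R : realType}.

Lemma measurable_fejer_weight m : measurable_fun setT (fejer_weight m : R -> R).
Proof. exact: continuous_measurable_fun (@fejer_weight_continuous R m). Qed.

Lemma integral_torus (f : R -> R) : measurable_fun setT f -> (forall x, 0 <= f x) ->
  (\int[torus_measure R]_x (f x)%:E =
   ((pi *+ 2)^-1%R)%:E * \int[lebesgue_measure]_(x in `[0%R, (pi *+ 2)%R]) (f x)%:E)%E.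
Proof.
move=> mf f0.
have := @integral_uniform R 0 (pi *+ 2) (two_pi_gt0 R) (EFin \o f).
rewrite subr0; apply; first exact/measurable_EFinP.
by move=> x; rewrite lee_fin.
Qed.

Lemma period_shift (a : R) : exists l : int, 0 <= a + l%:~R * (pi *+ 2) <= pi *+ 2.
Proof.
have p0 : 0 < pi *+ 2 :> R := two_pi_gt0 R.
exists (- Num.floor (a / (pi *+ 2))).
have E : a = a / (pi *+ 2) * (pi *+ 2) by rewrite divfK// gt_eqF.
rewrite {1 3}E mulrNz mulNr -mulrBl.
have /andP[f1 f2] := floor_itv (a / (pi *+ 2)).
rewrite mulr_ge0 ?(ltW p0) ?subr_ge0//=.
rewrite ler_piMl ?(ltW p0)// lerBlDl ltW//; move: f2; by rewrite intrD addrC.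
Qed.

(** By periodicity the center may be moved into the fundamental interval, where three
    Cauchy weights dominate, each of integral at most [pi]. *)
Lemma integral_fejer_weight (m : nat) (a : R) :
  (\int[torus_measure R]_x (fejer_weight m (x - a))%:E <= 6%:E)%E.
Proof.
have p0 : 0 < pi *+ 2 :> R := two_pi_gt0 R.
have [l /andP[l0 l1]] := period_shift a.
set b := a + _ in l0 l1.
have mb c : measurable_fun setT (fun x : R => x - c) by exact: measurable_funB.
have mf : measurable_fun setT (fun x : R => fejer_weight m (x - b)).
  exact: (measurableT_comp (measurable_fejer_weight m) (mb b)).
have mc c : measurable_fun setT (fun x : R => cauchy_weight m (x - c)).
  exact: continuous_measurable_fun (@cauchy_weight_continuous R m c).
have -> : (fun x : R => (fejer_weight m (x - a))%:E) = (fun x : R => (fejer_weight m (x - b))%:E).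
  apply/funext => x; rewrite -(fejer_weight_periodic m (x - a) (- l)).
  by congr (fejer_weight m _)%:E; rewrite /b mulrNz; ring.
rewrite integral_torus//; last by move=> x; exact: fejer_weight_ge0.
pose c (z : R) (x : R) := (cauchy_weight m (x - z))%:E.
have c0 z x : (0 <= c z x)%E by rewrite lee_fin cauchy_weight_ge0.
have mcE z D : measurable_fun D (c z).
  by apply: measurable_funTS; apply/measurable_EFinP.
have mI : measurable (`[0%R, pi *+ 2] : set R) by [].
pose I : set R := `[0%R, pi *+ 2]%classic.
have m3 : measurable_fun I (fun x => c b x + c (b + pi *+ 2)%R x + c (b - pi *+ 2)%R x)%E.
  by apply: emeasurable_funD; [apply: emeasurable_funD|]; exact: mcE.
apply: (@le_trans _ _ (((pi *+ 2)^-1%R)%:E *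
   (4%:E * \int[lebesgue_measure]_(x in I) (c b x + c (b + pi *+ 2)%R x + c (b - pi *+ 2)%R x)))%E).
  rewrite lee_pmul2l ?lte_fin ?invr_gt0//.
  rewrite -(@ge0_integralZl _ _ _ lebesgue_measure _ mI); last 3 first.
  - exact: m3.
  - by move=> x _; rewrite !adde_ge0 ?c0.
  - by rewrite lee_fin.
  apply: ge0_le_integral => //.
  - by move=> x _; rewrite lee_fin fejer_weight_ge0.
  - by apply: measurable_funTS; apply/measurable_EFinP.
  - exact: emeasurable_funM.
  move=> x; rewrite /= in_itv/= => /andP[x0 x2].
  rewrite /c -!EFinD -EFinM lee_fin.
  have -> : x - (b + pi *+ 2) = x - b - pi *+ 2 by ring.
  have -> : x - (b - pi *+ 2) = x - b + pi *+ 2 by ring.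
  by apply: fejer_weight_le; rewrite ler_norml; apply/andP; split; lra.
have m2 : measurable_fun I (fun x => c b x + c (b + pi *+ 2)%R x)%E.
  by apply: emeasurable_funD; exact: mcE.
rewrite (@ge0_integralD _ _ _ lebesgue_measure I mI _ _ _ m2 _ (mcE _ I)); last 2 first.
- by move=> x _; rewrite adde_ge0 ?c0.
- by move=> x _; exact: c0.
rewrite (@ge0_integralD _ _ _ lebesgue_measure I mI _ _ _ (mcE _ I) _ (mcE _ I)); last 2 first.
- by move=> x _; exact: c0.
- by move=> x _; exact: c0.
have I1 z : (\int[lebesgue_measure]_(x in I) c z x <= pi%:E)%E.
  exact: integral_cauchy_weight.
apply: (@le_trans _ _ (((pi *+ 2)^-1%R)%:E * (4%:E * (pi%:E + pi%:E + pi%:E)))%E).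
  rewrite lee_pmul2l ?lte_fin ?invr_gt0// lee_pmul2l// !leeD//.
rewrite -!EFinD -!EFinM lee_fin mulrC ler_pdivrMr//; lra.
Qed.

End TorusFejer.

(** * Integration of complex functions on the torus *)

Section ComplexIntegrals.
Context {R : realType}.
Local Open Scope complex_scope.
Local Notation mu := (torus_measure R).
Implicit Types (u v : R -> R[i]).

Definition cintegrable u : Prop :=
  mu.-integrable setT (EFin \o (fun x => complex.Re (u x))) /\
  mu.-integrable setT (EFin \o (fun x => complex.Im (u x))).

Lemma ReB (a b : R[i]) : complex.Re (a - b) = complex.Re a - complex.Re b.
Proof. by case: a b => [? ?] [? ?]. Qed.

Lemma ImB (a b : R[i]) : complex.Im (a - b) = complex.Im a - complex.Im b.
Proof. by case: a b => [? ?] [? ?]. Qed.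

Lemma ReD (a b : R[i]) : complex.Re (a + b) = complex.Re a + complex.Re b.
Proof. by case: a b => [? ?] [? ?]. Qed.

Lemma ImD (a b : R[i]) : complex.Im (a + b) = complex.Im a + complex.Im b.
Proof. by case: a b => [? ?] [? ?]. Qed.

Lemma ReM (a b : R[i]) :
  complex.Re (a * b) = complex.Re a * complex.Re b - complex.Im a * complex.Im b.
Proof. by case: a b => [? ?] [? ?]. Qed.

Lemma ImM (a b : R[i]) :
  complex.Im (a * b) = complex.Re a * complex.Im b + complex.Im a * complex.Re b.
Proof. by case: a b => [? ?] [? ?]. Qed.

Lemma normc_Re (z : R[i]) : `|complex.Re z| <= Normc.normc z.
Proof. by rewrite -lecR; exact: normc_ge_Re. Qed.

Lemma normc_Im (z : R[i]) : `|complex.Im z| <= Normc.normc z.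
Proof. by case: z => a b /=; rewrite -sqrtr_sqr ler_wsqrtr// lerDr sqr_ge0. Qed.

Lemma normc_le (z : R[i]) : Normc.normc z <= `|complex.Re z| + `|complex.Im z|.
Proof.
case: z => a b /=; have ab0 : 0 <= `|a| + `|b| by rewrite addr_ge0.
rewrite -(ler_pXn2r (n := 2))// ?nnegrE ?sqrtr_ge0//.
rewrite sqr_sqrtr ?addr_ge0 ?sqr_ge0// sqrrD !real_normK ?num_real//.
by rewrite addrAC lerDl mulrn_wge0// mulr_ge0.
Qed.

Lemma cintegrableB u v : cintegrable u -> cintegrable v -> cintegrable (fun x => u x - v x).
Proof.
move=> [u1 u2] [v1 v2]; split.
  apply: eq_integrable (integrableB measurableT u1 v1) => // x _ /=.
  by rewrite ReB EFinB.
apply: eq_integrable (integrableB measurableT u2 v2) => // x _ /=.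
by rewrite ImB EFinB.
Qed.

Lemma torus_integralB u v : cintegrable u -> cintegrable v ->
  torus_integral (fun x => u x - v x) = torus_integral u - torus_integral v.
Proof.
move=> [u1 u2] [v1 v2]; rewrite /torus_integral.
under eq_Rintegral do rewrite ReB.
under [X in _ +i* X]eq_Rintegral do rewrite ImB.
by rewrite !RintegralB.
Qed.

Lemma cintegrableD u v : cintegrable u -> cintegrable v -> cintegrable (fun x => u x + v x).
Proof.
move=> [u1 u2] [v1 v2]; split.
  apply: eq_integrable (integrableD measurableT u1 v1) => // x _ /=.
  by rewrite ReD EFinD.
apply: eq_integrable (integrableD measurableT u2 v2) => // x _ /=.
by rewrite ImD EFinD.
Qed.

Lemma torus_integralD u v : cintegrable u -> cintegrable v ->
  torus_integral (fun x => u x + v x) = torus_integral u + torus_integral v.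
Proof.
move=> [u1 u2] [v1 v2]; rewrite /torus_integral.
under eq_Rintegral do rewrite ReD.
under [X in _ +i* X]eq_Rintegral do rewrite ImD.
by rewrite !RintegralD.
Qed.

Lemma integrable_scale (c : R) (f : R -> R) : mu.-integrable setT (EFin \o f) ->
  mu.-integrable setT (EFin \o (fun x => c * f x)).
Proof.
by move=> h; apply: eq_integrable (integrableZl measurableT c h).
Qed.

Lemma cintegrableZ (c : R[i]) u : cintegrable u -> cintegrable (fun x => c * u x).
Proof.
move=> [u1 u2]; split.
  have h := integrableB measurableT (integrable_scale (complex.Re c) u1)
    (integrable_scale (complex.Im c) u2).
  by apply: eq_integrable h => // x _ /=; rewrite ReM EFinB.
have h := integrableD measurableT (integrable_scale (complex.Re c) u2)
  (integrable_scale (complex.Im c) u1).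
by apply: eq_integrable h => // x _ /=; rewrite ImM EFinD.
Qed.

Lemma torus_integralZ (c : R[i]) u : cintegrable u ->
  torus_integral (fun x => c * u x) = c * torus_integral u.
Proof.
move=> [u1 u2]; rewrite /torus_integral.
under eq_Rintegral do rewrite ReM.
under [X in _ +i* X]eq_Rintegral do rewrite ImM.
rewrite RintegralB//; [|exact: integrable_scale|exact: integrable_scale].
rewrite RintegralD//; [|exact: integrable_scale|exact: integrable_scale].
by rewrite !RintegralZl//; case: c.
Qed.

Lemma cintegrable_sum n (F : nat -> R -> R[i]) : (forall k, cintegrable (F k)) ->
  cintegrable (fun x => \sum_(0 <= k < n) F k x).
Proof.
move=> iF; elim: n => [|n IH].
  under eq_fun do rewrite big_geq//.
  by split; exact: integrable0.
under eq_fun do rewrite big_nat_recr//=.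
exact: cintegrableD.
Qed.

Lemma torus_integral_sum n (F : nat -> R -> R[i]) : (forall k, cintegrable (F k)) ->
  torus_integral (fun x => \sum_(0 <= k < n) F k x) =
  \sum_(0 <= k < n) torus_integral (F k).
Proof.
move=> iF; elim: n => [|n IH].
  under eq_fun do rewrite big_geq//.
  by rewrite /torus_integral big_geq//= /Rintegral !integral0.
under eq_fun do rewrite big_nat_recr//=.
rewrite torus_integralD//; last exact: cintegrable_sum.
by rewrite IH big_nat_recr.
Qed.

Lemma measurable_normc u : complex_measurable u ->
  measurable_fun [set: measurableTypeR R] (fun x => Normc.normc (u x)).
Proof.
move=> [mr mi].
have -> : (fun x => Normc.normc (u x)) =
    (fun x => (complex.Re (u x) ^+ 2 + complex.Im (u x) ^+ 2) `^ 2^-1).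
  apply/funext => x; rewrite powR12_sqrt ?addr_ge0 ?sqr_ge0//.
  by case: (u x).
apply: (measurableT_comp (measurable_powR 2^-1)).
by apply: measurable_funD; exact: measurable_funX.
Qed.

Lemma cintegrable_measurable u : cintegrable u -> complex_measurable u.
Proof.
by move=> [u1 u2]; split; apply/measurable_EFinP; [exact: measurable_int u1|exact: measurable_int u2].
Qed.

(** The constant 2 comes from treating real and imaginary parts separately. *)
Lemma normc_torus_integral_le u : cintegrable u ->
  ((Normc.normc (torus_integral u))%:E <=
   2%:E * \int[mu]_x (Normc.normc (u x))%:E)%E.
Proof.
move=> iu; have [u1 u2] := iu.
have part (f : R -> R) : mu.-integrable setT (EFin \o f) ->
    (forall x, `|f x| <= Normc.normc (u x)) ->
    measurable_fun setT (fun x => (Normc.normc (u x))%:E) ->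
    (`|Rintegral mu setT f|%:E <= \int[mu]_x (Normc.normc (u x))%:E)%E.
  move=> fi fu mn.
  rewrite EFin_normr_Rintegral//.
  apply: le_trans (le_abse_integral _ measurableT (measurable_int _ fi)) _.
  apply: ge0_le_integral => //.
  - by apply: measurableT_comp => //; exact: (measurable_int _ fi).
  - by move=> x _; rewrite lee_fin.
have mn : measurable_fun setT (fun x => (Normc.normc (u x))%:E).
  apply/measurable_EFinP; exact: measurable_normc (cintegrable_measurable iu).
have h1 := part _ u1 (fun x => normc_Re (u x)) mn.
have h2 := part _ u2 (fun x => normc_Im (u x)) mn.
apply: le_trans (_ : (_ + _)%:E <= _)%E; first by rewrite lee_fin; exact: normc_le.
rewrite EFinD; apply: le_trans (leeD h1 h2) _.
by rewrite mule_natl mule2n.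
Qed.

End ComplexIntegrals.

(** * The error as an integral operator *)

Section ConvolutionKernels.
Context {R : realType}.
Local Open Scope complex_scope.
Local Notation mu := (torus_measure R).
Implicit Types (u v g : R -> R[i]).

Lemma complex_measurableD u v : complex_measurable u -> complex_measurable v ->
  complex_measurable (fun x => u x + v x).
Proof.
move=> [u1 u2] [v1 v2]; split.
  by under eq_fun do rewrite ReD; exact: measurable_funD.
by under eq_fun do rewrite ImD; exact: measurable_funD.
Qed.

Lemma complex_measurableB u v : complex_measurable u -> complex_measurable v ->
  complex_measurable (fun x => u x - v x).
Proof.
move=> [u1 u2] [v1 v2]; split.
  by under eq_fun do rewrite ReB; exact: measurable_funB.
by under eq_fun do rewrite ImB; exact: measurable_funB.
Qed.

Lemma complex_measurableM u v : complex_measurable u -> complex_measurable v ->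
  complex_measurable (fun x => u x * v x).
Proof.
move=> [u1 u2] [v1 v2]; split.
  under eq_fun do rewrite ReM.
  by apply: measurable_funB; exact: measurable_funM.
under eq_fun do rewrite ImM.
by apply: measurable_funD; exact: measurable_funM.
Qed.

Lemma complex_measurable_cst (c : R[i]) : complex_measurable (fun _ : R => c).
Proof. by split; exact: measurable_cst. Qed.

Lemma complex_measurable_sum I (s : seq I) (F : I -> R -> R[i]) :
  (forall i, complex_measurable (F i)) ->
  complex_measurable (fun x => \sum_(i <- s) F i x).
Proof.
move=> mF; elim: s => [|i s IH].
  by under eq_fun do rewrite big_nil; exact: complex_measurable_cst.
by under eq_fun do rewrite big_cons; exact: complex_measurableD.
Qed.

Lemma complex_measurable_comp u (a : R -> R) : complex_measurable u ->
  measurable_fun setT a -> complex_measurable (fun x => u (a x)).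
Proof.
by move=> [u1 u2] ma; split; [exact: (measurableT_comp u1 ma)|exact: (measurableT_comp u2 ma)].
Qed.

Lemma complex_measurable_trigsum n (c : int -> R) : complex_measurable (trigsum n c).
Proof.
rewrite /trigsum /symsum; apply: complex_measurable_sum => i.
apply: complex_measurableM; first exact: complex_measurable_cst.
have me : complex_measurable (@expi R).
  split; apply: continuous_measurable_fun.
    exact: continuous_cos.
  exact: continuous_sin.
apply: (complex_measurable_comp me).
exact: measurable_funM.
Qed.

Lemma complex_measurable_phi (lam : R -> R) (r kappa : R) : 1 < r ->
  (exists M : R, forall x, `|lam x| <= M) -> is_mask r kappa lam ->
  complex_measurable (phi lam) /\
  exists K : R, forall x, Normc.normc (phi lam x) <= K.
Proof.
move=> hr hlamb hlam.
have [Phi [rem [rem0 phiE phi_rem]]] := phi_uniform hr hlamb hlam.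
split.
  have -> : phi lam = (fun x => (Phi x)%:C) by apply/funext.
  split; last exact: measurable_cst.
  pose a (k : int) := lam k%:~R.
  apply: (@measurable_fun_cvg _ _ _ setT (fun n x => complex.Re (trigsum n a x))).
    by move=> n; case: (complex_measurable_trigsum n a).
  move=> x _; apply/cvgrPdist_le => e e0.
  move/cvgrPdist_le : rem0 => /(_ e e0); apply: filterS => n.
  rewrite sub0r normrN => re.
  apply: le_trans re; apply: le_trans (ler_norm _).
  have h := phi_rem n x.
  by have := le_trans (normc_ge_Re _) h; rewrite lecR ReB.
exists (symsum 0 (fun k => `|lam k%:~R|) + rem 0%N) => x.
have -> : phi lam x = trigsum 0 (fun k => lam k%:~R) x +
    ((Phi x)%:C - trigsum 0 (fun k => lam k%:~R) x).
  by rewrite phiE; ring.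
have nE (z : R[i]) : (Normc.normc z)%:C = `|z| by [].
rewrite -lecR nE rmorphD/=; apply: le_trans (ler_normD _ _) _; apply: lerD => //.
exact: normc_trigsum.
Qed.

Lemma bounded_of_le (f : R -> R) (K : R) : (forall x, `|f x| <= K) ->
  [bounded f x | x in [set: R]].
Proof.
move=> fK; exists K; split; first exact: num_real.
by move=> y Ky x _; apply: le_trans (fK x) (ltW Ky).
Qed.

Lemma cintegrable_mul (k : R -> R[i]) g (K : R) : complex_measurable k ->
  (forall x, Normc.normc (k x) <= K) -> cintegrable g -> cintegrable (fun x => k x * g x).
Proof.
move=> [k1 k2] kK [g1 g2].
have b1 : [bounded complex.Re (k x) | x in [set: R]].
  by apply: (@bounded_of_le _ K) => x; apply: le_trans (normc_Re _) (kK x).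
have b2 : [bounded complex.Im (k x) | x in [set: R]].
  by apply: (@bounded_of_le _ K) => x; apply: le_trans (normc_Im _) (kK x).
split.
  have h := integrableB measurableT (integrableMr measurableT k1 b1 g1)
    (integrableMr measurableT k2 b2 g2).
  by apply: eq_integrable h => // x _ /=; rewrite ReM EFinB !EFinM.
have h := integrableD measurableT (integrableMr measurableT k1 b1 g2)
  (integrableMr measurableT k2 b2 g1).
by apply: eq_integrable h => // x _ /=; rewrite ImM EFinD !EFinM.
Qed.

(** The torus has finite measure, so [L^p] is contained in [L^1]. *)
Lemma torus_Lp_cintegrable (p : \bar R) g : (1 <= p)%E -> torus_Lp p g -> cintegrable g.
Proof.
move=> p1 [mg _ gfin].
have mG := measurable_normc mg.
have fin : torus_measure R [set: measurableTypeR R] \is a fin_num.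
  by rewrite (_ : torus_measure R setT = 1%E)//; exact: probability_setT.
pose G : measurableTypeR R -> R := fun x => Normc.normc (g x).
have Gp : G \in Lfun (torus_measure R) p.
  by rewrite inE; apply/andP; split; rewrite inE.
have G1 : G \in Lfun (torus_measure R) 1%E by exact: (Lfun_subset _ _ _ p1 Gp).
have iG : (torus_measure R).-integrable setT (EFin \o G) by apply/Lfun1_integrable; exact: G1.
case: mg => m1 m2; split.
  apply: le_integrable iG => //; first exact/measurable_EFinP.
  move=> x _; rewrite /= lee_fin.
  by apply: le_trans (normc_Re _) _; exact: ler_norm.
apply: le_integrable iG => //; first exact/measurable_EFinP.
move=> x _; rewrite /= lee_fin.
by apply: le_trans (normc_Im _) _; exact: ler_norm.
Qed.

Lemma complex_measurable_kernelH (theta : R -> R) m : cutoff theta -> (0 < m)%N ->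
  complex_measurable (kernelH theta m) /\
  exists K : R, forall x, Normc.normc (kernelH theta m x) <= K.
Proof.
move=> ht m0.
have -> : kernelH theta m = trigsum m (fun k => theta (k%:~R / m%:R)).
  by apply/funext => x; exact: kernelHE.
split; first exact: complex_measurable_trigsum.
exists (symsum m (fun k => `|theta (k%:~R / m%:R)|)) => x.
by rewrite -lecR; exact: normc_trigsum.
Qed.

Lemma measurable_subl (x : R) : measurable_fun setT (fun t : R => x - t).
Proof. by apply: measurable_funB. Qed.

(** Linearity of the integral; every integrand is a bounded measurable function times [g]. *)
Lemma error_kernel_convolution (theta lam : R -> R) (r kappa : R) m g x :
  cutoff theta -> 1 < r -> (exists M : R, forall x, `|lam x| <= M) ->
  is_mask r kappa lam -> (0 < m)%N -> cintegrable g ->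
  cintegrable (fun t => error_kernel theta lam m x t * g t) /\
  torus_conv (phi lam) g x - opQ theta lam m g x =
    torus_integral (fun t => error_kernel theta lam m x t * g t).
Proof.
move=> ht hr hlamb hlam m0 ig.
have [mphi [K1 bphi]] := complex_measurable_phi hr hlamb hlam.
have [mH [K2 bH]] := complex_measurable_kernelH ht m0.
have i1 : cintegrable (fun t => phi lam (x - t) * g t).
  apply: (@cintegrable_mul _ _ K1) => //.
  exact: complex_measurable_comp mphi (measurable_subl x).
have i2 k : cintegrable (fun t => kernelH theta m (node R m k - t) * g t).
  apply: (@cintegrable_mul _ _ K2) => //.
  exact: complex_measurable_comp mH (measurable_subl _).
pose c k : R[i] := m.*2.+1%:R^-1 * phi lam (x - node R m k).
have i3 k : cintegrable (fun t => c k * (kernelH theta m (node R m k - t) * g t)).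
  exact: cintegrableZ.
have E : (fun t => error_kernel theta lam m x t * g t) =
    (fun t => phi lam (x - t) * g t - \sum_(0 <= k < m.*2.+1)
       c k * (kernelH theta m (node R m k - t) * g t)).
  apply/funext => t; rewrite /error_kernel mulrBl mulr_sumr mulr_suml.
  by congr (_ - _); apply: eq_bigr => k _; rewrite /c; ring.
rewrite E; split; first by apply: cintegrableB => //; exact: cintegrable_sum.
rewrite torus_integralB//; last exact: cintegrable_sum.
rewrite torus_integral_sum// /opQ mulr_sumr; congr (_ - _).
by apply: eq_bigr => k _; rewrite torus_integralZ// /c /opV /torus_conv; ring.
Qed.

End ConvolutionKernels.

(** * The error bound *)

Theorem theorem2p7 (R : realType) (theta : R -> R) (p : \bar R)
    (r kappa : R) (lam : R -> R)
    (htheta : cutoff theta)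
    (hp : (1 <= p)%E)
    (hr : 1 < r)
    (hlam0 : forall x, lam x != 0)
    (hlamb : exists M : R, forall x, `|lam x| <= M)
    (hlam : is_mask r kappa lam) :
  exists c : R, 0 < c /\
    forall (f g : R -> R[i]) (m : nat),
      generates lam p f g -> (0 < m)%N ->
      (torus_norm p (fun x => f x - opQ theta lam m g x)%R <=
       (c * m%:R `^ (- r) * ln (m%:R + 1) `^ (- kappa))%:E * torus_norm p g)%E.
Proof.
have [A A0 HA] := error_kernel_le htheta hr hlamb hlam.
(* The weight is 2 A omega(m) times the Fejer weight, of integral at most 12 A omega(m);
   the Schur test doubles this. *)
exists (24 * A); split; first by rewrite mulr_gt0.
move=> f g m [[mf _ _] Lg fE] m0.
have mR1 : 1 <= m%:R :> R by rewrite ler1n.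
set om := omega r kappa m%:R.
have om0 : 0 < om by exact: omega_gt0.
have -> : 24 * A * m%:R `^ (- r) * ln (m%:R + 1) `^ (- kappa) = 2 * (12 * (A * om)).
  by rewrite /om /omega; ring.
have ig := torus_Lp_cintegrable hp Lg.
have Lg' := Lg; case: Lg' => mg _ _.
have [mphi [K1 bphi]] := complex_measurable_phi hr hlamb hlam.
have c0 : 0 < 2 * (A * om) by rewrite mulr_gt0 ?ltr0n//; exact: mulr_gt0.
have B0 : 0 < 12 * (A * om) by rewrite mulr_gt0 ?ltr0n//; exact: mulr_gt0.
pose T := measurableTypeR R.
pose w (z : T * T) : R := 2 * (A * om) * fejer_weight m (z.1 - z.2).
have mw : measurable_fun setT w.
  apply: measurable_funM => //.
  apply: (measurableT_comp (measurable_fejer_weight m)).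
  by apply: measurable_funB.
have w0 z : 0 <= w z by rewrite mulr_ge0 ?fejer_weight_ge0// ltW.
have wt (t : T) : (\int[torus_measure R]_x (w (x, t))%:E <= (12 * (A * om))%:E)%E.
  rewrite /w /=; under eq_integral do rewrite EFinM.
  rewrite ge0_integralZl//; last 3 first.
  - apply/measurable_EFinP; apply: (measurableT_comp (measurable_fejer_weight m)).
    by apply: measurable_funB.
  - by move=> x _; rewrite lee_fin fejer_weight_ge0.
  - by rewrite lee_fin ltW.
  have -> : 12 * (A * om) = 2 * (A * om) * 6 by ring.
  by rewrite (EFinM (2 * (A * om)) 6) lee_pmul2l ?lte_fin//; exact: integral_fejer_weight.
have wx (x : T) : (\int[torus_measure R]_t (w (x, t))%:E <= (12 * (A * om))%:E)%E.
  under eq_integral => t _.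
    rewrite /w/= -fejer_weightN opprB; over.
  exact: wt.
pose h (x : T) : R := Normc.normc (f x - opQ theta lam m g x).
pose G (x : T) : R := Normc.normc (g x).
have mQ : complex_measurable (opQ theta lam m g).
  apply: complex_measurableM; first exact: complex_measurable_cst.
  apply: complex_measurable_sum => k.
  apply: complex_measurableM; first exact: complex_measurable_cst.
  by apply: (complex_measurable_comp mphi); apply: measurable_funB.
have mh : measurable_fun setT h by exact: measurable_normc (complex_measurableB mf mQ).
have mG : measurable_fun setT G by exact: measurable_normc.
have n0 (z : R[i]) : 0 <= Normc.normc z by case: z => a b; exact: sqrtr_ge0.
have hG : {ae torus_measure R, forall x, ((h x)%:E <= \int[torus_measure R]_t (w (x, t) * G t)%:E)%E}.
  have [N [mN N0 sN]] := fE; exists N; split => // x nx; apply: sN => fx; apply: nx.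
  rewrite /= /h (fx : f x = _).
  have [iK ->] := error_kernel_convolution x htheta hr hlamb hlam m0 ig.
  apply: le_trans (normc_torus_integral_le iK) _.
  have mK := measurable_normc (cintegrable_measurable iK).
  rewrite -ge0_integralZl//; last 2 first.
  - by apply/measurable_EFinP.
  - by move=> t _; rewrite lee_fin.
  apply: ge0_le_integral => //.
  - by move=> t _; rewrite -EFinM lee_fin mulr_ge0.
  - by apply: emeasurable_funM => //; apply/measurable_EFinP.
  - apply/measurable_EFinP; apply: measurable_funM => //.
    exact: (measurableT_comp mw (pair1_measurable x)).
  move=> t _; rewrite -EFinM lee_fin Normc.normcM.
  have -> : w (x, t) * G t = 2 * (A * om * fejer_weight m (x - t) * G t).
    by rewrite /w/=; ring.
  by rewrite ler_wpM2l// ler_wpM2r// -lecR; exact: HA.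
exact: (schur_test mw w0 mG (fun t => n0 _) mh (fun t => n0 _) B0 wx wt hG hp).
Qed.
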